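(* Let $E$ be a Banach lattice, let $F$ be a Dedekind complete Banach lattice, and let $T:E\to F$ be an order bounded operator. If $c_0$ does not embed in $F$, then $T$ and its modulus $|T|$ are $b$-weakly compact operators.
   Context: Operators are linear. An operator from a Banach lattice $E$ into a Banach space $X$ is $b$-weakly compact if it maps each subset of $E$ that is $b$-order bounded (i.e. order bounded in the topological bidual $E''$, where $E$ is viewed in $E''$ canonically) onto a relatively weakly compact subset of $X$. An operator between Riesz spaces is order bounded if it maps order bounded sets to order bounded sets. The modulus is $|T|=T\vee(-T)$, the supremum being taken in the ordered space of linear operators $E\to F$ (it exists since $F$ is Dedekind complete). ''$c_0$ embeds in $F$'' means that $F$ contains a closed subspace isomorphic to $c_0$. *)

(* Defs.v *)
From HB Require Import structures.
From mathcomp Require Import all_boot all_order all_algebra.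
From mathcomp Require Import all_classical all_reals all_analysis.

Set Implicit Arguments.
Unset Strict Implicit.
Unset Printing Implicit Defensive.

Import Order.TTheory GRing.Theory Num.Theory.
Import numFieldNormedType.Exports.

Local Open Scope classical_set_scope.
Local Open Scope ring_scope.

(* The order operations are fields of the mixin because Hierarchy Builder admits
   no join of [Order.POrder] and [Num.NormedZmodule] other than
   [Num.NumDomain].  The instances below give every Banach lattice the
   corresponding [Order.Lattice] structure.  In [bl_norm], [bl_join x (- x)] is
   the lattice modulus of x, whereas [`|x|] is its norm. *)
HB.mixin Record isBanachLattice (R : realType) V
    of CompleteNormedModule R V := {
  bl_le : rel V ;
  bl_join : V -> V -> V ;
  bl_meet : V -> V -> V ;
  bl_le_refl : reflexive bl_le ;
  bl_le_anti : antisymmetric bl_le ;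
  bl_le_trans : transitive bl_le ;
  bl_leUx : forall x y z : V, bl_le (bl_join x y) z = bl_le x z && bl_le y z ;
  bl_lexI : forall x y z : V, bl_le x (bl_meet y z) = bl_le x y && bl_le x z ;
  bl_leD2r : forall z x y : V, bl_le x y -> bl_le (x + z) (y + z) ;
  bl_scale_ge0 : forall (a : R) (x : V),
    0 <= a -> bl_le 0 x -> bl_le 0 (a *: x) ;
  bl_norm : forall x y : V,
    bl_le (bl_join x (- x)) (bl_join y (- y)) -> `|x| <= `|y|
}.

#[short(type="banachLatticeType")]
HB.structure Definition BanachLattice (R : realType) :=
  {V of CompleteNormedModule R V & isBanachLattice R V}.

HB.instance Definition _ (R : realType) (V : banachLatticeType R) :=
  Order.Le_isPOrder.Build ring_display (BanachLattice.sort V)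
    (@bl_le_refl R V) (@bl_le_anti R V) (@bl_le_trans R V).
HB.instance Definition _ (R : realType) (V : banachLatticeType R) :=
  Order.POrder_isMeetSemilattice.Build ring_display (BanachLattice.sort V)
    (@bl_lexI R V).
HB.instance Definition _ (R : realType) (V : banachLatticeType R) :=
  Order.POrder_isJoinSemilattice.Build ring_display (BanachLattice.sort V)
    (@bl_leUx R V).

(* [has_sup A] only says that A is nonempty and bounded above. *)
Definition dedekind_complete d (V : porderType d) : Prop :=
  forall A : set V, has_sup A -> supremums A !=set0.

Definition order_bounded d (V : porderType d) (A : set V) : Prop :=
  exists a b : V, A `<=` [set x | (a <= x <= b)%O].

Section SupNorm.
Context {R : realType} {U : Type} (B : set U).
Implicit Types f g : U -> R^o.

Definition sup_norm f : R := sup [set `|f x| | x in B].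

Definition bounded_over f := exists M : R, forall x, B x -> `|f x| <= M.

Hypothesis B0 : B !=set0.

Lemma sup_norm_has_sup f : bounded_over f -> has_sup [set `|f x| | x in B].
Proof.
move=> [M fM]; split; first by case: B0 => x Bx; exists `|f x|; exists x.
by exists M => _ [x Bx <-]; exact: fM.
Qed.

Lemma sup_norm_ub f x : bounded_over f -> B x -> `|f x| <= sup_norm f.
Proof.
by move=> fb Bx; apply: sup_upper_bound; [exact: sup_norm_has_sup|exists x].
Qed.

Lemma sup_norm_le f M : (forall x, B x -> `|f x| <= M) -> sup_norm f <= M.
Proof.
move=> fM; apply: ge_sup; first by case: B0 => x Bx; exists `|f x|; exists x.
by move=> _ [x Bx <-]; exact: fM.
Qed.

Lemma sup_norm_ge0 f : bounded_over f -> 0 <= sup_norm f.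
Proof.
by case: B0 => x Bx fb; apply: le_trans (sup_norm_ub fb Bx).
Qed.

Lemma sup_normD f g : bounded_over f -> bounded_over g ->
  sup_norm (f + g) <= sup_norm f + sup_norm g.
Proof.
move=> fb gb; apply: sup_norm_le => x Bx; apply: le_trans (ler_normD _ _) _.
by apply: lerD; exact: sup_norm_ub.
Qed.

Lemma sup_normZ_le (a : R) f : bounded_over f ->
  sup_norm (a *: f) <= `|a| * sup_norm f.
Proof.
move=> fb; apply: sup_norm_le => x Bx; rewrite [_ x]/(a * f x) normrM.
by rewrite ler_wpM2l// sup_norm_ub.
Qed.

Lemma bounded_overZ (a : R) f : bounded_over f -> bounded_over (a *: f).
Proof.
move=> [M fM]; exists (`|a| * M) => x Bx; rewrite [_ x]/(a * f x) normrM.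
by rewrite ler_wpM2l// fM.
Qed.

Lemma sup_normZ (a : R) f : bounded_over f ->
  sup_norm (a *: f) = `|a| * sup_norm f.
Proof.
move=> fb; apply/eqP; rewrite eq_le sup_normZ_le//=.
have [->|a0] := eqVneq a 0.
  by rewrite normr0 mul0r; apply/sup_norm_ge0/bounded_overZ.
rewrite -ler_pdivlMl ?normr_gt0// -normfV.
have {1}-> : f = a^-1 *: (a *: f) by rewrite scalerA mulVf// scale1r.
exact/sup_normZ_le/bounded_overZ.
Qed.

Lemma sup_norm_eq0 f x : bounded_over f -> sup_norm f = 0 -> B x -> f x = 0.
Proof.
move=> fb f0 Bx; apply/eqP; rewrite -normr_le0 -f0.
exact: sup_norm_ub.
Qed.

End SupNorm.

Section Dual.
Context {R : realType} {E : normedModType R}.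

Definition dual_pred : {pred E -> R^o} :=
  mem [set f : E -> R^o | linear f /\ continuous f].

Lemma dual_pred_submod : submod_closed dual_pred.
Proof.
split=> [|a f g /set_mem[lf cf] /set_mem[lg cg]]; apply/mem_set; split.
- by move=> a x y; rewrite scaler0 addr0.
- exact: cst_continuous.
- move=> b x y; have fg z : (a *: f + g) z = a * f z + g z by [].
  rewrite !fg lf lg -![b *: _]/(b * _) !mulrDr addrACA; congr (_ + _ + _).
  by rewrite !mulrA (mulrC a).
- by move=> x; apply: cvgD; [apply: cvgZr; exact: cf|exact: cg].
Qed.

HB.instance Definition _ := GRing.isSubmodClosed.Build R (E -> R^o)
  dual_pred dual_pred_submod.

End Dual.

Arguments dual_pred {R} E.

Record dual (R : realType) (E : normedModType R) := Dual {
  dual_fun :> E -> R^o ;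
  dual_funP : dual_fun \in dual_pred E }.

HB.instance Definition _ (R : realType) (E : normedModType R) :=
  [isSub for @dual_fun R E].
HB.instance Definition _ (R : realType) (E : normedModType R) :=
  [Choice of dual E by <:].
HB.instance Definition _ (R : realType) (E : normedModType R) :=
  [SubChoice_isSubLmodule of dual E by <:].

Section DualNorm.
Context {R : realType} {E : normedModType R}.
Implicit Types f g : dual E.

Lemma dual_linear f : linear f.
Proof. by have /set_mem[] := dual_funP f. Qed.

Lemma dual_continuous f : continuous f.
Proof. by have /set_mem[] := dual_funP f. Qed.

HB.instance Definition _ f :=
  GRing.isLinear.Build R E R^o *:%R (dual_fun f) (dual_linear f).

Definition dual_norm f : R := sup_norm [set x : E | `|x| <= 1] f.

Lemma unit_ball_neq0 : [set x : E | `|x| <= 1] !=set0.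
Proof. by exists 0; rewrite /= normr0. Qed.

Lemma dual_bounded f : bounded_over [set x : E | `|x| <= 1] f.
Proof.
have /linear_boundedP[M [_ fM]] :=
  (linear_bounded_continuous f).2 (@dual_continuous f).
exists (`|M| + 1) => x /= x1; apply: le_trans (fM (`|M| + 1) _ x) _.
  by rewrite (le_lt_trans (ler_norm _))// ltrDl.
by rewrite ler_piMr.
Qed.

Lemma dual_normD f g : dual_norm (f + g) <= dual_norm f + dual_norm g.
Proof.
rewrite /dual_norm -[dual_fun (f + g)]/(val (f + g)) raddfD.
exact: (sup_normD unit_ball_neq0 (dual_bounded f) (dual_bounded g)).
Qed.

Lemma dual_normZ (a : R) f : dual_norm (a *: f) = `|a| * dual_norm f.
Proof.
rewrite /dual_norm -[dual_fun (a *: f)]/(val (a *: f)) linearZ.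
exact: (sup_normZ unit_ball_neq0 a (dual_bounded f)).
Qed.

Lemma dual_le_norm f x : `|f x| <= dual_norm f * `|x|.
Proof.
have [->|x0] := eqVneq x 0; first by rewrite linear0 !normr0 mulr0.
have fx : `|f (`|x|^-1 *: x)| = `|f x| / `|x|.
  by rewrite linearZ /= [X in `|X|]/(_ * _) normrM normfV normr_id mulrC.
rewrite -ler_pdivrMr ?normr_gt0// -fx.
apply: (sup_norm_ub unit_ball_neq0 (dual_bounded f)).
by rewrite /= normrZ normfV !normr_id mulVf// normr_eq0.
Qed.

Lemma dual_norm_eq0 f : dual_norm f = 0 -> f = 0.
Proof.
move=> f0; apply/val_inj/funext => x; apply/eqP.
by rewrite -normr_le0 (le_trans (dual_le_norm f x))// f0 mul0r.
Qed.

End DualNorm.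

HB.instance Definition _ (R : realType) (E : normedModType R) :=
  Lmodule_isNormed.Build R (dual E) dual_normD dual_normZ dual_norm_eq0.

Section Bidual.
Context {R : realType} {E : normedModType R}.

Lemma bidual_emb_subproof (x : E) :
  (fun f : dual E => f x : R^o) \in dual_pred (dual E).
Proof.
have lin : linear (fun f : dual E => f x : R^o).
  move=> a f g; rewrite -[dual_fun (a *: f + g)]/(val (a *: f + g)).
  by rewrite linearP.
apply/mem_set; split=> //.
pose h := HB.pack_for {linear dual E -> R^o} (fun f : dual E => f x : R^o)
  (GRing.isLinear.Build R (dual E) R^o *:%R _ lin).
apply: (@linear_bounded_continuous R (dual E) R^o h).1.
apply/linear_boundedP; exists `|x|; split=> [|M xM f]; first exact: num_real.
rewrite (le_trans (dual_le_norm f x))// -[dual_norm f]/(`|f|) mulrC.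
by rewrite ler_wpM2r// ltW.
Qed.

Definition bidual_emb (x : E) : dual (dual E) := Dual (bidual_emb_subproof x).

End Bidual.

(* The evaluation map X -> R^X' (product topology on R^X') induces exactly the
   coarsest topology making every continuous linear functional continuous. *)
Definition weak (R : realType) (X : normedModType R) : Type :=
  initial_topology
    (fun x : X => (fun f : dual X => f x) : {ptws dual X -> R^o}).

HB.instance Definition _ (R : realType) (X : normedModType R) :=
  Topological.on (weak X).

Definition relatively_weakly_compact (R : realType) (X : normedModType R)
  (A : set X) : Prop := compact (closure (A : set (weak X))).

Section BanachLatticeDual.
Context {R : realType} {E : banachLatticeType R}.

Definition dual_le (f g : dual E) : Prop := forall x : E, 0 <= x -> f x <= g x.

Definition bidual_le (p q : dual (dual E)) : Prop :=
  forall f : dual E, dual_le 0 f -> p f <= q f.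

Definition b_order_bounded (A : set E) : Prop :=
  exists p q : dual (dual E), forall x, A x ->
    bidual_le p (bidual_emb x) /\ bidual_le (bidual_emb x) q.

End BanachLatticeDual.

Definition b_weakly_compact (R : realType) (E : banachLatticeType R)
  (X : completeNormedModType R) (T : {linear E -> X}) : Prop :=
  forall A : set E, b_order_bounded A -> relatively_weakly_compact (T @` A).

Section Operators.
Context {R : realType} {E F : banachLatticeType R}.
Implicit Types S T U : {linear E -> F}.

Definition order_bounded_operator T : Prop :=
  forall A : set E, order_bounded A -> order_bounded (T @` A).

Definition operator_le S T : Prop := forall x : E, 0 <= x -> S x <= T x.

Definition is_modulus T S : Prop :=
  [/\ operator_le T S, operator_le (\- T) S
    & forall U, operator_le T U -> operator_le (\- T) U -> operator_le S U].

Lemma operator_le_anti S T : operator_le S T -> operator_le T S -> S =1 T.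
Proof.
move=> ST TS; have pos (x : E) : 0 <= x -> S x = T x.
  by move=> x0; apply/le_anti; rewrite ST// TS.
move=> x; pose y := Order.join x 0.
have y0 : 0 <= y by exact: leUr.
have yx0 : 0 <= y - x by rewrite -[0](subrr x); apply/bl_leD2r/leUl.
have split_x (U : {linear E -> F}) : U x = U y - U (y - x).
  by rewrite -raddfB subKr.
by rewrite !split_x !pos.
Qed.

Lemma is_modulus_unique T S S' : is_modulus T S -> is_modulus T S' -> S =1 S'.
Proof.
by move=> [TS NTS leS] [TS' NTS' leS']; apply: operator_le_anti; auto.
Qed.

End Operators.

Section C0.
Context {R : realType}.

Definition c0_pred : {pred nat -> R^o} :=
  mem [set u : nat -> R^o | u @ \oo --> (0 : R^o)].

Lemma c0_pred_submod : submod_closed c0_pred.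
Proof.
split=> [|a u v /set_mem cu /set_mem cv]; apply/mem_set; first exact: cvg_cst.
rewrite /=; have -> : (0 : R^o) = a *: 0 + 0 by rewrite scaler0 addr0.
by apply: cvgD; [exact: cvgZr|exact: cv].
Qed.

HB.instance Definition _ := GRing.isSubmodClosed.Build R (nat -> R^o)
  c0_pred c0_pred_submod.

End C0.

Arguments c0_pred : clear implicits.

Record c0 (R : realType) := C0 {
  c0_fun :> nat -> R^o ;
  c0_funP : c0_fun \in c0_pred R }.

HB.instance Definition _ (R : realType) := [isSub for @c0_fun R].
HB.instance Definition _ (R : realType) := [Choice of c0 R by <:].
HB.instance Definition _ (R : realType) :=
  [SubChoice_isSubLmodule of c0 R by <:].

Section C0Norm.
Context {R : realType}.
Implicit Types u v : c0 R.

Definition c0_norm u : R := sup_norm [set: nat] u.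

Lemma c0_bounded u : bounded_over [set: nat] u.
Proof.
have /set_mem cu := c0_funP u.
have [M [_ uM]] := cvg_seq_bounded (cvgP _ cu).
by exists (`|M| + 1) => n _; apply: uM => //;
  rewrite (le_lt_trans (ler_norm _))// ltrDl.
Qed.

Let nat_neq0 : [set: nat] !=set0. Proof. by exists 0%N. Qed.

Lemma c0_normD u v : c0_norm (u + v) <= c0_norm u + c0_norm v.
Proof.
rewrite /c0_norm -[c0_fun (u + v)]/(val (u + v)) raddfD.
exact: (sup_normD nat_neq0 (c0_bounded u) (c0_bounded v)).
Qed.

Lemma c0_normZ (a : R) u : c0_norm (a *: u) = `|a| * c0_norm u.
Proof.
rewrite /c0_norm -[c0_fun (a *: u)]/(val (a *: u)) linearZ.
exact: (sup_normZ nat_neq0 a (c0_bounded u)).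
Qed.

Lemma c0_norm_eq0 u : c0_norm u = 0 -> u = 0.
Proof.
move=> u0; apply/val_inj/funext => n; rewrite raddf0.
exact: (sup_norm_eq0 nat_neq0 (c0_bounded u) u0).
Qed.

End C0Norm.

HB.instance Definition _ (R : realType) :=
  Lmodule_isNormed.Build R (c0 R) c0_normD c0_normZ c0_norm_eq0.

(* The closed subspace of X is the range of J, and J is a linear homeomorphism
   onto it with inverse the restriction of K. *)
Definition c0_embeds (R : realType) (X : normedModType R) : Prop :=
  exists J : {linear c0 R -> X}, exists K : X -> c0 R,
    [/\ closed (range J), continuous J, cancel J K
      & {within range J, continuous K}].

(* Main.v *)
From HB Require Import structures.
Require Import Defs.
From mathcomp Require Import all_boot all_order all_algebra.
From mathcomp Require Import all_classical all_reals all_analysis.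
From mathcomp Require Import ring lra.

Set Implicit Arguments.
Unset Strict Implicit.
Unset Printing Implicit Defensive.

Import Order.TTheory GRing.Theory Num.Theory.
Import numFieldNormedType.Exports.

Local Open Scope classical_set_scope.
Local Open Scope ring_scope.

(** If an increasing norm-bounded sequence in F has gaps d_n bounded away from
    0, then functionals norming the d_n and Rosenthal's lemma single out a
    subsequence spanning a copy of c_0.  Hence every norm-bounded directed
    subset of F converges in norm to its supremum.

    For a positive operator S and p <= A <= q in E'', the y in F with
    S'' p <= y <= S'' q form a norm-bounded set directed in both directions, so
    S(A) lies in an order interval of F.  Splitting T as |T| - (|T| - T) gives
    the same for T, and it remains to see that order intervals of F are weakly
    compact.

    On [0, s] the norm is controlled by positive functionals f.  Composing f
    with Q x = sup_t (2 t x - t^2 s), which behaves like x^2 / s and satisfies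
    the parallelogram inequality, yields uniformly convex functions, and their
    near-minimizers over the convex members of an ultrafilter form a Cauchy
    filter base whose norm limit is the weak limit of the ultrafilter. *)

(** * Vector lattices *)

Section LatticeOrderedSpace.
Context {R : realType} {V : banachLatticeType R}.
Implicit Types (x y z : V) (a : R).

Definition bl_abs x : V := Order.join x (- x).
Definition bl_pos x : V := Order.join x 0.

Lemma levD2r z x y : (x + z <= y + z) = (x <= y).
Proof.
apply/idP/idP => [|xy]; last exact: bl_leD2r.
by move=> /(@bl_leD2r _ _ (- z)); rewrite !addrK.
Qed.

Lemma levD2l z x y : (z + x <= z + y) = (x <= y).
Proof. by rewrite !(addrC z) levD2r. Qed.

Lemma levD x y z t : x <= y -> z <= t -> x + z <= y + t.
Proof. by move=> xy zt; apply: (@le_trans _ _ (y + z)); rewrite (levD2l, levD2r). Qed.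

Lemma subv_ge0 x y : (0 <= y - x) = (x <= y).
Proof. by rewrite -(levD2r x 0) add0r subrK. Qed.

Lemma levN2 x y : (- x <= - y) = (y <= x).
Proof. by rewrite -(subv_ge0 (- x)) opprK addrC subv_ge0. Qed.

Lemma levNl x y : (- x <= y) = (- y <= x).
Proof. by rewrite -(levN2 y) opprK. Qed.

Lemma oppv_le0 x : (- x <= 0) = (0 <= x).
Proof. by rewrite levNl oppr0. Qed.

Lemma levBlDr x y z : (x - y <= z) = (x <= z + y).
Proof. by rewrite -(levD2r y (x - y)) subrK. Qed.

Lemma levBrDr x y z : (x <= y - z) = (x + z <= y).
Proof. by rewrite -(levD2r z x) subrK. Qed.

Lemma addv_ge0 x y : 0 <= x -> 0 <= y -> 0 <= x + y.
Proof. by move=> x0 y0; rewrite -[0]addr0; exact: levD. Qed.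

Lemma levDr x y : 0 <= y -> x <= x + y.
Proof. by move=> y0; rewrite -{1}[x]addr0 levD2l. Qed.

Lemma levDl x y : 0 <= y -> x <= y + x.
Proof. by rewrite addrC; exact: levDr. Qed.

Lemma scalev_ge0 a x : 0 <= a -> 0 <= x -> 0 <= a *: x.
Proof. exact: bl_scale_ge0. Qed.

Lemma levZ a x y : 0 <= a -> x <= y -> a *: x <= a *: y.
Proof. by move=> a0 xy; rewrite -subv_ge0 -scalerBr scalev_ge0 ?subv_ge0. Qed.

Lemma levZr a b x : a <= b -> 0 <= x -> a *: x <= b *: x.
Proof. by move=> ab x0; rewrite -subv_ge0 -scalerBl scalev_ge0 ?subr_ge0. Qed.

Lemma double_ge0 x : 0 <= x + x -> 0 <= x.
Proof.
move=> xx; have -> : x = 2^-1 *: (x + x).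
  by rewrite -[x in x + _]scale1r -[x in _ + x]scale1r -scalerDl scalerA
    mulVf ?scale1r// -natrD pnatr_eq0.
by rewrite scalev_ge0// invr_ge0.
Qed.

Lemma joinvD x y z : Order.join x y + z = Order.join (x + z) (y + z).
Proof.
apply/le_anti/andP; split; last by rewrite leUx !levD2r leUl leUr.
by rewrite -levBrDr leUx !levBrDr leUl leUr.
Qed.

Lemma meetvE x y : Order.meet x y = - Order.join (- x) (- y).
Proof.
apply/le_anti/andP; split.
  by rewrite -levN2 opprK leUx !levN2 leIl leIr.
by rewrite lexI levNl leUl levNl leUr.
Qed.

Lemma joinv_meetv x y : Order.join x y + Order.meet x y = x + y.
Proof.
rewrite meetvE; apply/eqP; rewrite subr_eq; apply/eqP.
by rewrite addrC joinvD [LHS]joinC addKr addrCA addNr addr0 joinC.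
Qed.

Lemma posv_ge0 x : 0 <= bl_pos x. Proof. exact: leUr. Qed.

Lemma le_posv x : x <= bl_pos x. Proof. exact: leUl. Qed.

Lemma absv_ge0 x : 0 <= bl_abs x.
Proof.
by apply: double_ge0; rewrite -[X in X <= _](subrr x) levD ?leUl ?leUr.
Qed.

Lemma le_absv x : x <= bl_abs x. Proof. exact: leUl. Qed.

Lemma leN_absv x : - x <= bl_abs x. Proof. exact: leUr. Qed.

Lemma absv_le x y : (bl_abs x <= y) = (x <= y) && (- x <= y).
Proof. exact: leUx. Qed.

Lemma absvN x : bl_abs (- x) = bl_abs x.
Proof. by rewrite /bl_abs opprK joinC. Qed.

Lemma absv_id x : 0 <= x -> bl_abs x = x.
Proof.
move=> x0; apply/le_anti; rewrite le_absv absv_le lexx /=.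
by rewrite andbT (le_trans _ x0)// oppv_le0.
Qed.

Lemma posv_id x : 0 <= x -> bl_pos x = x.
Proof. by move=> x0; apply/le_anti; rewrite le_posv leUx lexx x0. Qed.

Lemma posv_eq0 x : x <= 0 -> bl_pos x = 0.
Proof. by move=> x0; apply/le_anti; rewrite posv_ge0 leUx lexx x0. Qed.

Lemma posvB x : bl_pos x - bl_pos (- x) = x.
Proof.
apply/eqP; rewrite subr_eq; apply/eqP.
by rewrite addrC joinvD addNr add0r joinC.
Qed.

Lemma posvZ a x : 0 <= a -> bl_pos (a *: x) = a *: bl_pos x.
Proof.
have le_pos b y : 0 <= b -> bl_pos (b *: y) <= b *: bl_pos y.
  by move=> b0; rewrite leUx levZ ?le_posv// scalev_ge0 ?posv_ge0.
rewrite le_eqVlt => /orP[/eqP<-|a0]; first by rewrite !scale0r posv_id.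
apply/le_anti/andP; split; first exact/le_pos/ltW.
have ai0 : 0 <= a^-1 by rewrite invr_ge0 ltW.
have := levZ (ltW a0) (le_pos _ (a *: x) ai0).
by rewrite !scalerA mulfV ?gt_eqF// mulVf ?gt_eqF// !scale1r.
Qed.

(** Translation gives |x| = (2x)^+ - x, homogeneity gives (2x)^+ = 2x^+, and subtracting x = x^+ -
    x^- leaves x^+ + x^-. *)
Lemma posvD_absv x : bl_pos x + bl_pos (- x) = bl_abs x.
Proof.
have -> : bl_abs x = bl_pos (x *+ 2) - x by rewrite joinvD mulr2n addrK add0r.
rewrite -scaler_nat posvZ ?ler0n// scaler_nat mulr2n.
have := posvB x; move: (bl_pos x) (bl_pos (- x)) => p q <-.
by rewrite opprB addrACA subrr addr0.
Qed.

Lemma posv_le_absv x : bl_pos x <= bl_abs x.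
Proof. by rewrite -posvD_absv levDr ?posv_ge0. Qed.

Lemma absvD x y : bl_abs (x + y) <= bl_abs x + bl_abs y.
Proof. by rewrite absv_le opprD !levD ?le_absv ?leN_absv. Qed.

Lemma posvD x y : bl_pos (x + y) <= bl_pos x + bl_pos y.
Proof. by rewrite leUx levD ?le_posv// addv_ge0 ?posv_ge0. Qed.

Lemma le_posv2 x y : x <= y -> bl_pos x <= bl_pos y.
Proof. by move=> xy; rewrite leUx posv_ge0 (le_trans xy) ?le_posv. Qed.

Lemma joinvE x y : Order.join x y = bl_pos (x - y) + y.
Proof. by rewrite joinvD subrK add0r. Qed.

Lemma norm_absv_le x y : bl_abs x <= bl_abs y -> `|x| <= `|y|.
Proof. exact: bl_norm. Qed.

Lemma norm_absv x : `|bl_abs x| = `|x|.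
Proof.
by apply/le_anti; rewrite !norm_absv_le// (absv_id (absv_ge0 x)).
Qed.

Lemma norm_ge0_le x y : 0 <= x -> x <= y -> `|x| <= `|y|.
Proof.
by move=> x0 xy; apply: norm_absv_le; rewrite !absv_id ?(le_trans x0 xy).
Qed.

Lemma norm_le_of_absv x y : bl_abs x <= y -> `|x| <= `|y|.
Proof. by move=> xy; rewrite -norm_absv norm_ge0_le ?absv_ge0. Qed.

Lemma norm_posv_le x : `|bl_pos x| <= `|x|.
Proof. by rewrite -[leRHS]norm_absv norm_ge0_le ?posv_ge0 ?posv_le_absv. Qed.

(** Since y <= z, (y - x)^+ <= (z - x)^+, which has norm below e; hence (y - x)^+ = 0. This is the
    norm closedness of the positive cone. *)
Lemma le_approx x y :
  (forall e : R, 0 < e -> exists2 z, y <= z & `|z - x| < e) -> y <= x.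
Proof.
move=> yx; suff /eqP : `|bl_pos (y - x)| = 0.
  rewrite normr_eq0 => /eqP p0.
  by rewrite -[x]add0r -p0 -levBlDr le_posv.
apply/le_anti; rewrite normr_ge0 andbT; apply/ler_addgt0Pr => e e0.
rewrite add0r; have [z yz zx] := yx e e0; apply: le_trans (ltW zx).
apply: le_trans (norm_posv_le _).
by rewrite norm_ge0_le ?posv_ge0// le_posv2// levD2r.
Qed.

Lemma ge_approx x y :
  (forall e : R, 0 < e -> exists2 z, z <= y & `|z - x| < e) -> x <= y.
Proof.
move=> yx; rewrite -levN2; apply: le_approx => e /yx[z zy zx].
by exists (- z); rewrite ?levN2// opprK addrC distrC.
Qed.

Lemma riesz_decomposition x y z : 0 <= x -> 0 <= z ->
  - (x + z) <= y <= x + z ->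
  exists y1 y2, [/\ y = y1 + y2, - x <= y1 <= x & - z <= y2 <= z].
Proof.
move=> x0 z0 /andP[yl yu].
have xx : - x <= x by rewrite (le_trans _ x0)// oppv_le0.
(* The truncation of y to [-x, x]; the bounds on y leave a remainder in [-z, z]. *)
pose y1 := Order.meet (Order.join y (- x)) x.
exists y1, (y - y1); split; first by rewrite subrKC.
  by rewrite lexI leUr xx leIr.
apply/andP; split.
  rewrite levBrDr addrC levBlDr; apply: le_trans (leIl _ _) _.
  by rewrite leUx levDr//= -levBlDr -opprD.
rewrite levBlDr addrC -levBlDr lexI; apply/andP; split.
  by rewrite levBlDr (le_trans (leUl y (- x)))// levDr.
by rewrite levBlDr.
Qed.

End LatticeOrderedSpace.

(** * The Hahn-Banach theorem *)

Section HahnBanach.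
Context {R : realType} {V : lmodType R}.
Implicit Types (p q : V -> R) (x y v : V) (a : R).

Definition sublinear p :=
  (forall x y, p (x + y) <= p x + p y) /\
  (forall a x, 0 <= a -> p (a *: x) <= a * p x).

Lemma sublinear0 p : sublinear p -> p 0 = 0.
Proof.
move=> [pD pZ]; apply/le_anti; have := pZ 0 0 (lexx _).
rewrite scale0r mul0r => -> /=; have := pD 0 0; rewrite addr0; lra.
Qed.

Lemma sublinearZ p a x : sublinear p -> 0 <= a -> p (a *: x) = a * p x.
Proof.
move=> sp; rewrite le_eqVlt => /orP[/eqP<-|a0].
  by rewrite scale0r mul0r sublinear0.
apply/le_anti; rewrite (sp.2 _ _ (ltW a0))/= -ler_pdivlMl//.
have -> : p x = p (a^-1 *: (a *: x)).
  by rewrite scalerA mulVf ?gt_eqF// scale1r.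
by rewrite sp.2// invr_ge0 ltW.
Qed.

Lemma sublinearN_ge p x : sublinear p -> - p (- x) <= p x.
Proof.
move=> sp; have := sp.1 x (- x); rewrite subrr (sublinear0 sp); lra.
Qed.

(** For sublinear p, a linear functional below p lies below [ray_inf p v] exactly when its value at
    v is p v. *)
Definition ray_inf p v x : R := inf [set p (x + t *: v) - t * p v | t in >= 0].

Lemma ray_inf_le p v x t : sublinear p -> 0 <= t ->
  ray_inf p v x <= p (x + t *: v) - t * p v.
Proof.
move=> sp t0; apply: ge_inf; last by exists t.
(* Subadditivity at s v = (x + s v) + (- x) bounds the set below, so the infimum is a genuine
   one. *)
exists (- p (- x)) => _ [s /= s0 <-].
have := sp.1 (x + s *: v) (- x); rewrite (addrC x) addrK.
have := sublinearZ v sp s0; lra.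
Qed.

Lemma le_ray_inf p v x b :
  (forall t, 0 <= t -> b <= p (x + t *: v) - t * p v) -> b <= ray_inf p v x.
Proof.
move=> bp; apply: lb_le_inf; last by move=> _ [t /= t0 <-]; exact: bp.
by exists (p (x + 0 *: v) - 0 * p v); exists 0 => /=.
Qed.

Lemma ray_inf_sublinear p v : sublinear p -> sublinear (ray_inf p v).
Proof.
move=> sp; split=> [x y|a x].
  rewrite -lerBlDr; apply: le_ray_inf => t t0.
  rewrite lerBlDl -lerBlDr; apply: le_ray_inf => s s0.
  have /le_trans := ray_inf_le v (x + y) sp (addr_ge0 t0 s0).
  rewrite lerBlDr; apply.
  have := sp.1 (x + t *: v) (y + s *: v).
  by rewrite addrACA -scalerDl mulrDl; lra.
rewrite le_eqVlt => /orP[/eqP<-|a0].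
  have := ray_inf_le v (0 *: x) sp (lexx 0).
  by rewrite !scale0r !mul0r addr0 (sublinear0 sp) subr0.
rewrite mulrC -ler_pdivrMr//; apply: le_ray_inf => t t0.
rewrite ler_pdivrMr//.
have := ray_inf_le v (a *: x) sp (mulr_ge0 (ltW a0) t0).
rewrite -scalerA -scalerDr => /le_trans; apply.
by have := sp.2 a (x + t *: v) (ltW a0); lra.
Qed.

Lemma ray_inf_le_self p v x : sublinear p -> ray_inf p v x <= p x.
Proof.
by move=> sp; have := ray_inf_le v x sp (lexx 0);
  rewrite scale0r addr0 mul0r subr0.
Qed.

Definition pointwise_inf (A : set (V -> R)) x : R := inf [set p x | p in A].

(** Subadditivity needs a chain: if q is chosen for x and r for y, the smaller of the two serves
    both points. The common majorant p0 keeps the infimum finite, since q x >= - q (- x) >= - p0 (-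
    x). *)
Lemma pointwise_inf_sublinear (A : set (V -> R)) p0 :
  A !=set0 -> (forall q, A q -> sublinear q /\ forall x, q x <= p0 x) ->
  (forall q r, A q -> A r -> (forall x, q x <= r x) \/ (forall x, r x <= q x)) ->
  sublinear (pointwise_inf A) /\
  (forall q, A q -> forall x, pointwise_inf A x <= q x).
Proof.
move=> [q0 Aq0] Asub Atot.
have le_q q x : A q -> pointwise_inf A x <= q x.
  move=> Aq; apply: ge_inf; last by exists q.
  exists (- p0 (- x)) => _ [r Ar <-].
  have [sr rp] := Asub r Ar; have := sublinearN_ge x sr; have := rp (- x); lra.
have ge_q x b : (forall q, A q -> b <= q x) -> b <= pointwise_inf A x.
  move=> bq; apply: lb_le_inf; first by exists (q0 x), q0.
  by move=> _ [q Aq <-]; exact: bq.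
split; last by move=> q Aq x; exact: le_q.
split=> [x y|a x a0].
  rewrite -lerBlDr; apply: (ge_q) => q Aq; rewrite lerBlDl -lerBlDr.
  apply: (ge_q) => r Ar; rewrite lerBlDr.
  have [qr|rq] := Atot q r Aq Ar.
    by have := (Asub q Aq).1.1 x y; have := le_q _ (x + y) Aq; have := qr y; lra.
  by have := (Asub r Ar).1.1 x y; have := le_q _ (x + y) Ar; have := rq x; lra.
move: a0; rewrite le_eqVlt => /orP[/eqP<-|a0].
  rewrite mul0r scale0r -(sublinear0 (Asub q0 Aq0).1); exact: le_q.
rewrite mulrC -ler_pdivrMr//; apply: (ge_q) => q Aq; rewrite ler_pdivrMr//.
by rewrite (le_trans (le_q q _ Aq))// mulrC (Asub q Aq).1.2// ltW.
Qed.

(** Minimality forces [ray_inf p y] to equal p, and the term t = 1 of that infimum yields p x + p y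
    <= p (x + y). Additivity then gives oddness and full homogeneity. *)
Lemma minimal_sublinear_linear p : sublinear p ->
  (forall q, sublinear q -> (forall x, q x <= p x) -> q =1 p) ->
  linear (p : V -> R^o).
Proof.
move=> sp pmin.
have pD x y : p (x + y) = p x + p y.
  apply/le_anti; rewrite sp.1/=.
  have {1}<- := pmin _ (ray_inf_sublinear y sp) (fun z => ray_inf_le_self y z sp).
  by have := ray_inf_le y x sp ler01; rewrite scale1r mul1r; lra.
have pN x : p (- x) = - p x.
  by have := pD x (- x); rewrite subrr (sublinear0 sp); lra.
have pZ a x : 0 <= a -> p (a *: x) = a * p x.
  move=> a0; apply/le_anti; rewrite sp.2//=.
  by have := sp.2 a (- x) a0; rewrite scalerN !pN mulrN; lra.
move=> a x y; rewrite pD; congr (_ + _).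
have [/pZ//|a0] := leP 0 a.
by rewrite -[a in LHS]opprK scaleNr pN pZ ?oppr_ge0 ?ltW// mulNr opprK.
Qed.

(* A minimal sublinear minorant of p is linear; shrinking p to [ray_inf p v]
   first forces the value at v. *)
Theorem hahn_banach p v : sublinear p ->
  exists2 g : {linear V -> R^o}, (forall x, g x <= p x) & g v = p v.
Proof.
move=> sp; pose p0 := ray_inf p v.
have sp0 : sublinear p0 := ray_inf_sublinear v sp.
pose T := {q : V -> R | sublinear q /\ forall x, q x <= p0 x}.
(* The pointwise order is reversed, so a maximal element is a minimal sublinear functional. *)
pose le_T (q r : T) := `[< forall x, sval r x <= sval q x >].
have [||||q qmin] := @Zorn T le_T.
- by move=> q; apply/asboolP.
- move=> r q s /asboolP rq /asboolP qs; apply/asboolP => x.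
  exact: le_trans (qs x) (rq x).
- move=> [q Pq] [r Pr] /asboolP /= qr /asboolP /= rq.
  have e : q = r by apply/funext => x; apply/le_anti; rewrite qr rq.
  by subst r; congr exist; exact: Prop_irrelevance.
- move=> A Atot; have [[q0 Aq0]|A0] := pselect (A !=set0); last first.
    exists (exist _ p0 (conj sp0 (fun x => lexx _))) => q Aq.
    by exfalso; apply: A0; exists q.
  have [|||sq qle] := @pointwise_inf_sublinear [set sval q | q in A] p0.
  + by exists (sval q0), q0.
  + by move=> _ [q _ <-]; exact: (svalP q).
  + move=> _ _ [q Aq <-] [r Ar <-].
    by case: (Atot q r Aq Ar) => /asboolP; [right|left].
  have qle0 x : pointwise_inf [set sval q | q in A] x <= p0 x.
    apply: le_trans (qle (sval q0) _ x) _; first by exists q0.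
    exact: (svalP q0).2.
  pose r : T := exist _ (pointwise_inf _) (conj sq qle0).
  exists r => q Aq; apply/asboolP => x /=.
  by apply: qle; exists q.
have [sq qp0] := svalP q.
have lin_q : linear (sval q : V -> R^o).
  apply: minimal_sublinear_linear => // r sr rq x.
  have rp0 y : r y <= p0 y by exact: le_trans (rq y) (qp0 y).
  pose r_ : T := exist _ r (conj sr rp0); have := qmin r_.
  by move=> /(_ _)/(f_equal sval) /= <- //; apply/asboolP.
pose g := HB.pack_for {linear V -> R^o} (sval q : V -> R^o)
  (GRing.isLinear.Build R V R^o *:%R _ lin_q).
have gp x : g x <= p x by apply: le_trans (qp0 x) _; exact: ray_inf_le_self.
exists g => //; apply/le_anti; rewrite gp /=.
(* The term t = 1 gives p0 (- v) <= p 0 - p v = - p v, hence g v >= p v. *)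
have := qp0 (- v); have := ray_inf_le v (- v) sp ler01.
rewrite scale1r addNr mul1r (sublinear0 sp) -/p0 => a b.
have : g (- v) <= - p v by apply: le_trans b _; move: a; rewrite sub0r.
by rewrite linearN lerN2.
Qed.

End HahnBanach.

(** * Continuous functionals and positive functionals *)

Section DualEval.
Context {R : realType} {V : normedModType R}.
Implicit Types (f g : dual V) (x : V).

Lemma dual0E x : (0 : dual V) x = 0.
Proof. by rewrite -[dual_fun 0]/(val (0 : dual V)) raddf0. Qed.

Lemma dualDE f g x : (f + g) x = f x + g x.
Proof. by rewrite -[dual_fun (f + g)]/(val (f + g)) raddfD. Qed.

Lemma dualBE f g x : (f - g) x = f x - g x.
Proof. by rewrite -[dual_fun (f - g)]/(val (f - g)) raddfB. Qed.

Lemma dualZE (a : R) f x : (a *: f) x = a * f x.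
Proof. by rewrite -[dual_fun (a *: f)]/(val (a *: f)) linearZ. Qed.

Lemma dual_evalD f x y : f (x + y) = f x + f y.
Proof. exact: raddfD. Qed.

Lemma dual_evalB f x y : f (x - y) = f x - f y.
Proof. exact: raddfB. Qed.

Lemma dual_evalZ f (a : R) x : f (a *: x) = a * f x.
Proof. exact: linearZ. Qed.

Lemma dual_eval0 f : f 0 = 0.
Proof. exact: raddf0. Qed.

Lemma dual_of_linear (g : {linear V -> R^o}) (M : R) :
  (forall x, `|g x : R| <= M * `|x|) -> exists f : dual V, forall x, f x = g x.
Proof.
move=> gM; suff gd : (g : V -> R^o) \in dual_pred V by exists (Dual gd).
apply/mem_set; split; first exact: linearP.
apply: (@linear_bounded_continuous R V R^o g).1.
apply/linear_boundedP; exists M; split=> [|N MN x]; first exact: num_real.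
by rewrite (le_trans (gM x))// ler_wpM2r// ltW.
Qed.

Lemma dual_norm_le f (M : R) : 0 <= M ->
  (forall x, `|f x : R| <= M * `|x|) -> `|f| <= M.
Proof.
move=> M0 fM; apply: (sup_norm_le unit_ball_neq0) => x /= x1.
by rewrite (le_trans (fM x))// ler_piMr.
Qed.

Lemma dual_eval_le f x : `|f x : R| <= `|f| * `|x|.
Proof. exact: dual_le_norm. Qed.

End DualEval.

Section PositiveFunctionals.
Context {R : realType} {V : banachLatticeType R}.
Implicit Types (f g : dual V) (x v : V).

Definition pos_dual f := forall x, 0 <= x -> 0 <= (f x : R).

Lemma pos_dualP f : dual_le 0 f <-> pos_dual f.
Proof. by split=> f0 x x0; have := f0 x x0; rewrite dual0E. Qed.

Lemma pos_dual_le f x v : pos_dual f -> x <= v -> (f x : R) <= f v.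
Proof.
by move=> f0 xv; rewrite -subr_ge0 -raddfB f0// subv_ge0.
Qed.

(** Hahn-Banach for the sublinear map sending x to the norm of x^+. A functional below it is
    positive, because (- x)^+ = 0 for x >= 0, and contractive, because the norm of x^+ is at most
    that of x. *)
Lemma exists_norming_pos_dual v : exists f : dual V,
  [/\ pos_dual f, forall x, `|f x : R| <= `|x| & f v = `|bl_pos v|].
Proof.
have sp : sublinear (fun x : V => `|bl_pos x|).
  split=> [x y|a x a0]; last by rewrite posvZ// normrZ ger0_norm.
  by rewrite (le_trans _ (ler_normD _ _))// norm_ge0_le ?posvD ?posv_ge0.
have [g gp gv] := hahn_banach v sp.
have gle x : `|g x : R| <= 1 * `|x|.
  rewrite mul1r ler_norml (le_trans (gp x)) ?norm_posv_le// andbT lerNl.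
  by rewrite -raddfN (le_trans (gp (- x)))// -(normrN x) norm_posv_le.
have [f fg] := dual_of_linear gle.
exists f; split=> [x x0|x|]; rewrite fg ?gv//; last by rewrite -[leRHS]mul1r.
rewrite -oppr_le0 -raddfN (le_trans (gp _))//.
by rewrite posv_eq0 ?normr0// oppv_le0.
Qed.

(** Hahn-Banach for the sublinear map sending x to f (x^+); functionals below it lie between 0 and
    f. With v = y - z this evaluates f at a join as g y + (f - g) z. *)
Lemma exists_pos_dual_split f v : pos_dual f -> exists g : dual V,
  [/\ pos_dual g, pos_dual (f - g) & g v = f (bl_pos v)].
Proof.
move=> f0.
have sp : sublinear (fun x : V => f (bl_pos x)).
  split=> [x y|a x a0]; last by rewrite posvZ// linearZ.
  by rewrite -raddfD pos_dual_le// posvD.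
have [g gp gv] := hahn_banach v sp.
have le_f x : f (bl_pos x) <= `|f| * `|x|.
  rewrite (le_trans (ler_norm _))// (le_trans (dual_eval_le _ _))//.
  by rewrite ler_wpM2l// norm_posv_le.
have gle x : `|g x : R| <= `|f| * `|x|.
  rewrite ler_norml (le_trans (gp x))// andbT lerNl -raddfN.
  by rewrite (le_trans (gp (- x)))// -(normrN x).
have [h hg] := dual_of_linear gle.
exists h; split=> [x x0|x x0|]; rewrite ?hg ?gv//.
  rewrite -oppr_le0 -raddfN (le_trans (gp _))//.
  by rewrite posv_eq0 ?raddf0// oppv_le0.
by rewrite dualBE hg subr_ge0 (le_trans (gp x))// posv_id.
Qed.

End PositiveFunctionals.

(** * Copies of c_0 *)

Section SequenceLimits.
Context {R : realType} {W : completeNormedModType R}.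
Implicit Types (x : nat -> W) (l : W) (b : R).

Lemma cauchy_norm_cvg x :
  (forall e : R, 0 < e ->
     exists N, forall m n, (N <= m)%N -> (N <= n)%N -> `|x m - x n| < e) ->
  cvgn x.
Proof.
move=> xC; apply/cauchy_cvgP/cauchy_ballP => e e0; have [N xN] := xC e e0.
pose A := x @` [set n | (N <= n)%N].
have xA : (x @ \oo) A by exists N => // n Nn; exists n.
exists (A, A) => //= -[_ _] /= [[m Nm <-] [n Nn <-]].
by rewrite -ball_normE; exact: xN.
Qed.

Lemma cvgn_dist_lt x l : x @ \oo --> l ->
  forall e : R, 0 < e -> exists N, forall n, (N <= n)%N -> `|x n - l| < e.
Proof.
move=> /cvgrPdist_lt xl e e0; have [N _ xN] := xl e e0.
by exists N => n Nn; rewrite distrC; exact: xN.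
Qed.

Lemma cauchy_norm_limit x :
  (forall e : R, 0 < e ->
     exists N, forall m n, (N <= m)%N -> (N <= n)%N -> `|x m - x n| < e) ->
  exists l, forall e : R, 0 < e ->
    exists N, forall n, (N <= n)%N -> `|x n - l| < e.
Proof. by move=> /cauchy_norm_cvg cx; exists (lim (x @ \oo)); exact: cvgn_dist_lt. Qed.

Lemma cvgn_norm_le x l b : x @ \oo --> l -> (forall n, `|x n| <= b) -> `|l| <= b.
Proof.
move=> /cvgn_dist_lt xl xb; apply/ler_addgt0Pr => e e0.
have [N /(_ N (leqnn N))] := xl e e0; have := xb N.
by have := ler_normB (x N) (x N - l); rewrite opprB addrC subrK; lra.
Qed.

Lemma cvgn_norm_ge x l b N : x @ \oo --> l ->
  (forall n, (N <= n)%N -> b <= `|x n|) -> b <= `|l|.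
Proof.
move=> /cvgn_dist_lt xl xb; apply/ler_addgt0Pr => e e0.
have [K /(_ _ (leq_maxr N K))] := xl e e0.
have := xb _ (leq_maxl N K).
by have := ler_normD (x (maxn N K) - l) l; rewrite subrK; lra.
Qed.

End SequenceLimits.

Lemma eventually_inv_lt (R : realType) (e : R) : 0 < e ->
  exists N, forall n, (N <= n)%N -> n.+1%:R^-1 < e.
Proof.
move=> e0; have := near_infty_natSinv_lt (PosNum e0).
by move=> [N _ xN]; exists N => n Nn; exact: xN.
Qed.

Section C0Complete.
Context {R : realType}.
Implicit Types u : c0 R.

Lemma c0_coord_le u i : `|u i : R| <= `|u|.
Proof.
by apply: (@sup_norm_ub _ _ [set: nat]) => //; exact: c0_bounded.
Qed.

Lemma c0_norm_le u (b : R) : (forall i, `|u i : R| <= b) -> `|u| <= b.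
Proof. by move=> ub; apply: sup_norm_le => //; exists 0%N. Qed.

Lemma c0BE u v i : (u - v) i = u i - v i.
Proof. by rewrite -[c0_fun (u - v)]/(val (u - v)) raddfB. Qed.

Lemma c0PE (a : R) u (v : c0 R) i : (a *: u + v) i = a * u i + v i.
Proof. by rewrite -[c0_fun (a *: u + v)]/(val (a *: u + v)) linearP. Qed.

Lemma c0_cvg u (e : R) : 0 < e ->
  exists N, forall i, (N <= i)%N -> `|u i : R| < e.
Proof.
move=> e0; have /set_mem /cvgrPdist_lt/(_ e e0)[N _ uN] := c0_funP u.
by exists N => i Ni; have := uN i Ni; rewrite /= sub0r normrN.
Qed.

Lemma c0_complete (x : nat -> c0 R) :
  (forall e : R, 0 < e ->
     exists N, forall m n, (N <= m)%N -> (N <= n)%N -> `|x m - x n| < e) ->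
  exists u, forall e : R, 0 < e ->
    exists N, forall n, (N <= n)%N -> `|x n - u| <= e.
Proof.
move=> xC.
have /choice[l lP] i : exists l : R, forall e : R, 0 < e ->
    exists N, forall n, (N <= n)%N -> `|(x n i : R) - l| < e.
  apply: (@cauchy_norm_limit R R^o (fun n => x n i)) => e /xC[N xN].
  exists N => m n Nm Nn; apply: le_lt_trans (xN m n Nm Nn).
  by rewrite -c0BE; exact: c0_coord_le.
have lN (e : R) : 0 < e ->
    exists N, forall n, (N <= n)%N -> forall i, `|(x n i : R) - l i| <= e.
  move=> e0; have [N xN] := xC _ e0; exists N => n Nn i.
  apply/ler_addgt0Pr => d d0; have [K lK] := lP i d d0.
  have := lK _ (leq_maxr N K).
  have := le_lt_trans (c0_coord_le _ i) (xN n _ Nn (leq_maxl N K)).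
  rewrite c0BE; set y := x (maxn N K) i => xy yl.
  have := ler_normD ((x n i : R) - y) (y - l i); rewrite addrA subrK; lra.
have cl : (l : nat -> R^o) \in c0_pred R.
  apply/mem_set/cvgrPdist_lt => e e0.
  have e2 : 0 < e / 2 by lra.
  have [N lN2] := lN _ e2; have [K xK] := c0_cvg (x N) e2.
  exists K => // i /= Ki; rewrite sub0r normrN.
  have := lN2 N (leqnn N) i; have := xK i Ki.
  have := ler_normB (x N i : R) ((x N i : R) - l i).
  by rewrite opprB addrC subrK; lra.
exists (C0 cl) => e e0; have [N lN1] := lN e e0; exists N => n Nn.
by apply: c0_norm_le => i; rewrite c0BE; exact: lN1.
Qed.

End C0Complete.

(** The lower bound makes the inverse Lipschitz on the range. It also pulls a sequence of images
    converging in X back to a Cauchy sequence, so completeness of c_0 closes the range. *)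
Lemma c0_embedsP (R : realType) (X : normedModType R) (J : {linear c0 R -> X})
    (a b : R) : 0 < b -> (forall u, `|J u| <= a * `|u|) ->
  (forall u, b * `|u| <= `|J u|) -> c0_embeds X.
Proof.
move=> b0 Ja Jb.
have Jdist u v : b * `|u - v| <= `|J u - J v|.
  by rewrite -raddfB; exact: Jb.
have Jinj : injective J.
  move=> u v uv; apply/eqP; rewrite -subr_eq0 -normr_le0.
  by have := Jdist u v; rewrite uv subrr normr0 pmulr_rle0.
(* The default value 0 is taken only off the range of J, where nothing is claimed about K. *)
pose K y := xget 0 [set u | J u = y].
have JK : cancel J K.
  by move=> u; apply: Jinj; have := @xgetPex _ 0 [set v | J v = J u]; apply; exists u.
exists J, K; split=> //.
- move=> y yJ.
  have near_y e : 0 < e -> exists u, `|y - J u| < e.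
    move=> e0; have [z [[u _ <-] uy]] := yJ _ (nbhsx_ballx y e e0).
    by exists u; move: uy; rewrite -ball_normE.
  have /choice[x xP] (n : nat) : exists u, `|y - J u| < n.+1%:R^-1.
    by apply: near_y; rewrite invr_gt0.
  have [|u uP] := @c0_complete R x.
    move=> e e0; have [N nN] := eventually_inv_lt (divr_gt0 (mulr_gt0 b0 e0) (@ltr0Sn R 1)).
    exists N => m n Nm Nn; rewrite -(ltr_pM2l b0).
    apply: le_lt_trans (Jdist _ _) _.
    have := xP m; have := xP n; have := nN m Nm; have := nN n Nn.
    move: (b * e) n.+1%:R^-1 m.+1%:R^-1 => d p q.
    have := ler_distD y (J (x m)) (J (x n)); rewrite (distrC _ y).
    lra.
  exists u => //; apply/eqP; rewrite -subr_eq0 -normr_le0.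
  apply/ler_addgt0Pr => e e0; rewrite add0r.
  have e2 : 0 < e / 2 by lra.
  have a1 : 0 < `|a| + 1 by rewrite ltr_wpDl.
  have [N nN] := eventually_inv_lt e2.
  have [L uL] := uP _ (divr_gt0 e2 a1).
  have := uL _ (leq_maxr N L); have := nN _ (leq_maxl N L).
  move: (maxn N L) => n; have := xP n; move: n.+1%:R^-1 => q xq qe un.
  have : `|J (x n) - J u| <= e / 2.
    rewrite -raddfB; apply: le_trans (Ja _) _.
    apply: (@le_trans _ _ ((`|a| + 1) * `|x n - u|)).
      by rewrite ler_wpM2r// ler_wpDr// ler_norm.
    by rewrite mulrC -ler_pdivlMr.
  by have := ler_distD (J (x n)) (J u) y; rewrite (distrC _ (J (x n))) (distrC (J (x n)) y); move: xq qe; lra.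
- apply: (@linear_bounded_continuous R (c0 R) X J).1.
  apply/linear_boundedP; exists a; split=> [|M aM u]; first exact: num_real.
  by rewrite (le_trans (Ja u))// ler_wpM2r// ltW.
- apply/subspace_continuousP => _ [u _ <-].
  apply/cvgrPdist_lt => e e0; rewrite near_withinE.
  have : \forall y \near J u, `|J u - y| < b * e.
    have := nbhsx_ballx (J u) (b * e) (mulr_gt0 b0 e0).
    by rewrite -ball_normE.
  apply: filterS => _ /[swap] -[v _ <-].
  rewrite /from_subspace !JK => uv.
  by rewrite -(ltr_pM2l b0) (le_lt_trans (Jdist _ _)).
Qed.

(** * Rosenthal's selection lemma *)

Section Selection.
Context {R : realType}.

Lemma filter_all_lt (T : Type) (U : set_system T) {FU : Filter U} m
    (P : nat -> set T) :
  (forall i, (i < m)%N -> U (P i)) ->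
  U [set t | forall i, (i < m)%N -> P i t].
Proof.
elim: m => [|m IHm] UP; first exact: filterS filterT.
have Um := UP m (ltnSn m).
have := IHm (fun i im => UP i (ltnW im)).
apply: filterS2 Um => t Pm Pt i; rewrite ltnS leq_eqVlt => /orP[/eqP->//|].
exact: Pt.
Qed.

(** Otherwise there are arbitrarily late columns k with a n k >= d for U-almost all n. Finitely many
    of them can be collected at once, so some row would contain more than M / d entries of size at
    least d. *)
Lemma ultra_eventually_small (a : nat -> nat -> R) (M : R)
    (U : set_system nat) (d : R) :
  (forall n k, 0 <= a n k) -> (forall n m, \sum_(0 <= k < m) a n k <= M) ->
  UltraFilter U -> 0 < d ->
  exists K, forall k, (K <= k)%N -> U [set n | a n k < d].
Proof.
move=> a_ge0 a_sum UU d0; apply: contrapT => nK.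
have big m : exists N, U [set n | m%:R * d <= \sum_(0 <= k < N) a n k].
  elim: m => [|m [N UN]].
    by exists 0%N; apply: filterS filterT => n _ /=; rewrite mul0r big_geq.
  have [k Nk nUk] : exists2 k, (N <= k)%N & ~ U [set n | a n k < d].
    apply: contrapT => nk; apply: nK; exists N => k Nk.
    by apply: contrapT => nUk; apply: nk; exists k.
  have [//|Uk] := in_ultra_setVsetC [set n | a n k < d] UU.
  exists k.+1; apply: filterS2 UN Uk => n /= nN /negP; rewrite -leNgt => dk.
  rewrite (big_cat_nat (leq0n N) (leqW Nk)) /= -natr1 mulrDl mul1r lerD//.
  by rewrite big_nat_recr//= (le_trans dk)// lerDr sumr_ge0.
have M0 : 0 <= M by have := a_sum 0 0; rewrite big_geq.
have [N] := big (Num.bound (M / d)).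
move=> /filter_ex[n /=]; apply/negP; rewrite -ltNge.
apply: le_lt_trans (a_sum n N) _.
by rewrite -ltr_pdivrMr// archi_boundP// divr_ge0// ltW.
Qed.

Variables (a : nat -> nat -> R) (M : R).
Hypothesis a_ge0 : forall n k, 0 <= a n k.
Hypothesis a_sum : forall n m, \sum_(0 <= k < m) a n k <= M.

Lemma row_eventually_small n (d : R) : 0 < d ->
  exists K, forall k, (K <= k)%N -> a n k < d.
Proof.
move=> d0; have [U [UU _]] := ultraFilterLemma (eventually_filter : ProperFilter \oo).
(* For a matrix all of whose rows are row n, membership in U no longer depends on the row index. *)
have [K KP] := @ultra_eventually_small (fun _ => a n) M U d (fun _ => a_ge0 n)
  (fun _ => a_sum n) UU d0.
by exists K => k /KP/filter_ex[].
Qed.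

Lemma sum_half_powers (m n : nat) :
  \sum_(m <= i < n) 2^-1 ^+ i.+1 <= 2^-1 ^+ m :> R.
Proof.
have [mn|/ltnW nm] := leqP m n; last by rewrite big_geq ?exprn_ge0.
suff -> : \sum_(m <= i < n) 2^-1 ^+ i.+1 = 2^-1 ^+ m - 2^-1 ^+ n :> R.
  by rewrite gerBl exprn_ge0.
elim: n mn => [|n IHn]; first by rewrite leqn0 => /eqP->; rewrite big_geq// subrr.
rewrite leq_eqVlt => /orP[/eqP->|mn]; first by rewrite big_geq// subrr.
by rewrite big_nat_recr//= IHn// exprS; set y := _ ^+ n; lra.
Qed.

Lemma half_powers_lt (e : R) : 0 < e ->
  exists N, forall n, (N <= n)%N -> 2^-1 ^+ n < e.
Proof.
move=> e0; have h : `|2^-1 : R| < 1 by rewrite ger0_norm; lra.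
have [N NP] := cvgn_dist_lt (cvg_expr h) e0.
by exists N => n /NP; rewrite subr0 ger0_norm// exprn_ge0.
Qed.

(** The indices are chosen one by one so that every off-diagonal entry in column h i is below d i,
    and the d i sum to at most e. Entries in later columns are small because rows tend to 0; those
    in later rows are small because each chosen column is already small along the ultrafilter U. *)
Lemma rosenthal (e : R) : 0 < e -> exists h : nat -> nat,
  (forall j, (h j < h j.+1)%N) /\
  (forall j m, \sum_(0 <= i < m | i != j) a (h j) (h i) <= e).
Proof.
move=> e0; pose d i : R := e * 2^-1 ^+ i.+1.
have d0 i : 0 < d i by rewrite mulr_gt0// exprn_gt0.
have [U [UU ooU]] := ultraFilterLemma (eventually_filter : ProperFilter \oo).
have FU : Filter U by exact: filter_filter.
(* The promise made when n becomes the i-th index: U-almost every later row is admissible for column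
   n. *)
pose good n i := U [set n' | a n' n < d i].
pose next_ok s n := (forall i, (i < size s)%N -> [/\ (nth 0%N s i < n)%N,
  a n (nth 0%N s i) < d i & a (nth 0%N s i) n < d (size s)]) /\ good n (size s).
pose next s := xget 0%N [set n | next_ok s n].
have nextP s : (forall i, (i < size s)%N -> good (nth 0%N s i) i) ->
    next_ok s (next s).
  move=> sgood; suff : U [set n | next_ok s n].
    by move=> /filter_ex[n Pn]; apply: (@xgetPex _ 0%N (next_ok s)); exists n.
  have tail_in K : U [set n | (K <= n)%N] by apply: ooU; exists K.
  apply: filterI; last first.
    have [K KP] := ultra_eventually_small a_ge0 a_sum UU (d0 (size s)).
    exact: filterS KP (tail_in K).
  apply: filter_all_lt => i si.
  have [K KP] := row_eventually_small (nth 0%N s i) (d0 (size s)).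
  have UQ := @filterI _ U FU _ _ (tail_in (nth 0%N s i).+1) (tail_in K).
  have Ui : U [set n | a n (nth 0%N s i) < d i] := sgood i si.
  apply: (@filterS _ U FU) (@filterI _ U FU _ _ Ui UQ) => n /= [an [sn Kn]]; split=> //.
  exact: KP.
pose S := fix S j := if j is j'.+1 then rcons (S j') (next (S j')) else [::].
pose h j := next (S j).
have sizeS j : size (S j) = j by elim: j => //= j; rewrite size_rcons => ->.
have nthS j i : (i < j)%N -> nth 0%N (S j) i = h i.
  elim: j => // j IHj; rewrite ltnS leq_eqVlt /= nth_rcons sizeS => /orP[/eqP->|ij].
    by rewrite ltnn eqxx.
  by rewrite ij IHj.
have hP j : next_ok (S j) (h j).
  elim/ltn_ind: j => j IHj; apply: nextP => i; rewrite sizeS => ij.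
  by rewrite nthS//; have [_] := IHj i ij; rewrite sizeS.
have hlt i j : (i < j)%N ->
    [/\ (h i < h j)%N, a (h j) (h i) < d i & a (h i) (h j) < d j].
  move=> ij; have [/(_ i) + _] := hP j.
  by rewrite sizeS nthS//; apply.
exists h; split=> [j|j m]; first by have [] := hlt j j.+1 (ltnSn j).
apply: (@le_trans _ _ (\sum_(0 <= i < m | i != j) d i)).
  apply: ler_sum => i ij; apply: ltW.
  by move: ij; rewrite neq_ltn => /orP[/hlt[]|/hlt[]].
apply: (@le_trans _ _ (\sum_(0 <= i < m) d i)).
  by rewrite big_mkcond /=; apply: ler_sum => i _; case: ifP => // _; exact: ltW.
by rewrite -mulr_sumr -[leRHS]mulr1 ler_pM2l// -(expr0 2^-1) sum_half_powers.
Qed.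

End Selection.

Section PositiveSeries.
Context {R : realType} {V : banachLatticeType R}.
Variables (v : nat -> V) (B : R).
Hypothesis v_ge0 : forall n, 0 <= v n.
Hypothesis v_sum : forall n, `|\sum_(0 <= i < n) v i| <= B.

Let S (u : c0 R) n : V := \sum_(0 <= i < n) (u i : R) *: v i.

Lemma bl_sum_ge0 m n : 0 <= \sum_(m <= i < n) v i.
Proof.
by elim/big_ind: _ => // x y; exact: addv_ge0.
Qed.

(** As the v i are positive, the modulus of the block is at most c times the sum of the v i, and
    monotonicity of the norm applies. *)
Lemma partial_sum_dist (u : c0 R) (c : R) m n : 0 <= c -> (m <= n)%N ->
  (forall i, (m <= i)%N -> `|u i : R| <= c) -> `|S u n - S u m| <= c * B.
Proof.
move=> c0 mn uc; rewrite /S (big_cat_nat (leq0n m) mn) /= addrAC subrr add0r.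
have absS : bl_abs (\sum_(m <= i < n) (u i : R) *: v i) <=
    c *: \sum_(m <= i < n) v i.
  rewrite scaler_sumr !big_nat; elim/big_rec2: _ => [|i x y /andP[mi _] xy].
    by rewrite absv_id.
  apply: le_trans (absvD _ _) _; apply: levD => //.
  have := uc i mi; rewrite ler_norml => /andP[cu uc'].
  by rewrite absv_le -scaleNr !levZr// lerNl.
apply: le_trans (norm_le_of_absv absS) _.
rewrite normrZ ger0_norm// ler_wpM2l//; apply: le_trans (v_sum n).
apply: norm_ge0_le; first exact: bl_sum_ge0.
by rewrite (big_cat_nat (leq0n m) mn) /= levDl// bl_sum_ge0.
Qed.

Lemma partial_sum_cvg (u : c0 R) : cvgn (S u).
Proof.
have B0 : 0 <= B by exact: le_trans (v_sum 0).
have B1 : 0 < B + 1 by rewrite ltr_wpDl.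
apply: cauchy_norm_cvg => e e0.
have e1 : 0 < e / 2 / (B + 1) by rewrite !divr_gt0.
have [N uN] := c0_cvg u e1; exists N.
have dist n : (N <= n)%N -> `|S u n - S u N| < e / 2.
  move=> Nn; apply: (@le_lt_trans _ _ (e / 2 / (B + 1) * B)).
    by apply: partial_sum_dist => [||i /uN/ltW//]; first exact: ltW.
  rewrite -[ltRHS](@divfK _ (B + 1)) ?gt_eqF// ltr_pM2l//; lra.
move=> m n /dist mN /dist nN.
by have := ler_distD (S u N) (S u m) (S u n); rewrite (distrC (S u N)); lra.
Qed.

Let J (u : c0 R) : V := lim (S u @ \oo).

Lemma series_op_linear : linear J.
Proof.
move=> a u w; apply/cvg_lim => //.
have -> : S (a *: u + w) = (fun n => a *: S u n + S w n).
  apply/funext => n; rewrite /S scaler_sumr -big_split /=.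
  by apply: eq_bigr => i _; rewrite [X in X *: _]c0PE scalerDl scalerA.
by apply: cvgD; [apply: cvgZr|]; exact: partial_sum_cvg.
Qed.

(* The functionals f_j almost diagonalize the v_i, which bounds |J u| below. *)
Lemma c0_embeds_of_positive_series (f : nat -> dual V) (e : R) : 0 < e ->
  (forall j x, `|f j x : R| <= `|x|) -> (forall j, e <= f j (v j)) ->
  (forall j i, 0 <= (f j (v i) : R)) ->
  (forall j m, \sum_(0 <= i < m | i != j) (f j (v i) : R) <= e / 2) ->
  c0_embeds V.
Proof.
move=> e0 f1 fe f0 foff.
pose J' := HB.pack_for {linear c0 R -> V} J
  (GRing.isLinear.Build R (c0 R) V *:%R _ series_op_linear).
apply: (@c0_embedsP _ _ J' B (e / 2)) => [|u|u]; first by rewrite divr_gt0.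
  rewrite -[J' u]/(J u); apply: (@cvgn_norm_le _ _ (S u) (J u) _ (@partial_sum_cvg u)) => n.
  have := @partial_sum_dist u `|u| 0 n (normr_ge0 _) (leq0n n).
  by rewrite {2}/S big_geq// subr0 mulrC; apply=> i _; exact: c0_coord_le.
(* Taking the supremum over j, [coord] becomes (e / 2) * |u| <= |J u|, with norms on both sides. *)
rewrite -[J' u]/(J u); suff coord j : e * `|u j : R| - e / 2 * `|u| <= `|J u|.
  have : `|u| <= (`|J u| + e / 2 * `|u|) / e.
    by apply: c0_norm_le => j; rewrite ler_pdivlMr// mulrC -lerBlDr.
  by rewrite ler_pdivlMr//; set y := `|u|; nra.
apply: (@cvgn_norm_ge _ _ (S u) (J u) _ j.+1 (@partial_sum_cvg u)) => n jn.
apply: le_trans (f1 j _); rewrite raddf_sum /=.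
rewrite (bigD1_seq j) ?iota_uniq ?mem_index_iota//=.
have off : `|\sum_(0 <= i < n | i != j) f j ((u i : R) *: v i) : R| <= e / 2 * `|u|.
  apply: le_trans (ler_norm_sum _ _ _) _.
  apply: (@le_trans _ _ (\sum_(0 <= i < n | i != j) (f j (v i) : R) * `|u|)).
    apply: ler_sum => i _; rewrite linearZ normrM (ger0_norm (f0 _ _)) mulrC.
    by rewrite ler_wpM2l// c0_coord_le.
  by rewrite -mulr_suml ler_wpM2r.
have diag : e * `|u j : R| <= `|f j ((u j : R) *: v j) : R|.
  by rewrite linearZ normrM (ger0_norm (f0 _ _)) mulrC ler_wpM2l.
apply: le_trans (lerB diag off) _.
by rewrite lerBlDr -[leLHS]normr_id; 
  move: (\sum_(_ <= _ < _ | _) _) (f j _) => x y; have := ler_normB (y + x) x; rewrite addrK normr_id.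
Qed.

End PositiveSeries.

Lemma increasing_gap_lt (R : realType) (V : banachLatticeType R) (x : nat -> V)
    (M e : R) : ~ c0_embeds V -> (forall n, x n <= x n.+1) ->
  (forall n, `|x n| <= M) -> 0 < e -> exists n, `|x n.+1 - x n| < e.
Proof.
move=> nc0 xS xM e0; apply: contrapT => ngap; apply: nc0.
pose d n := x n.+1 - x n.
have d0 n : 0 <= d n by rewrite subv_ge0.
have de n : e <= `|d n|.
  by rewrite leNgt; apply/negP => de; apply: ngap; exists n.
have xmono m n : (m <= n)%N -> x m <= x n.
  by elim: n => [|n IHn]; rewrite leq_eqVlt => /orP[/eqP->//|//] /IHn/le_trans; apply.
have xdist n : `|x n - x 0%N| <= M + M.
  by rewrite (le_trans (ler_normB _ _))// lerD.
have /choice[f fP] n := exists_norming_pos_dual (d n).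
pose a n k : R := f n (d k).
have a0 n k : 0 <= a n k by have [+ _ _] := fP n; apply.
(* The gaps telescope, so the row sum is the value of the contraction f n at x m - x 0. *)
have a_sum n m : \sum_(0 <= k < m) a n k <= M + M.
  rewrite /a -raddf_sum telescope_sumr//= (le_trans (ler_norm _))//.
  by have [_ f1 _] := fP n; rewrite (le_trans (f1 _)).
have e2 : 0 < e / 2 by rewrite divr_gt0.
have [h [hS hoff]] := rosenthal a0 a_sum e2.
(* The selected gaps are distinct steps of x, and the skipped ones are positive. *)
have sum_le m : \sum_(0 <= i < m) d (h i) <= x (h m) - x 0%N.
  elim: m => [|m IHm]; first by rewrite big_geq// subv_ge0 xmono.
  rewrite big_nat_recr//=; apply: le_trans (levD IHm (lexx _)) _.
  by rewrite /d [X in X <= _]addrC addrA subrK levD2r xmono.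
apply: (@c0_embeds_of_positive_series _ _ (fun i => d (h i)) (M + M) _ _
  (fun i => f (h i)) e) => //.
- move=> n; apply: le_trans (xdist (h n)).
  by apply: norm_ge0_le => //; apply: bl_sum_ge0.
- by move=> j y; have [_ + _] := fP (h j); apply.
- by move=> j; have [_ _ ->] := fP (h j); rewrite posv_id.
- by move=> j i; exact: a0.
Qed.

(** * Norm convergence of directed sets *)

Section DirectedSets.
Context {R : realType} {V : banachLatticeType R}.
Hypothesis nc0 : ~ c0_embeds V.
Implicit Types (D : set V) (x y z b s : V) (M e : R).

(** A positive functional norming (x - y)^+ shows that this vector vanishes. Vector inequalities
    thus reduce to real ones, open to linear arithmetic. *)
Lemma pos_dual_levP x y :
  (forall f : dual V, pos_dual f -> (f x : R) <= f y) -> x <= y.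
Proof.
move=> fxy; have [f [f0 _ fpos]] := exists_norming_pos_dual (x - y).
have /le_anti/eqP : `|bl_pos (x - y)| <= 0 <= `|bl_pos (x - y)|.
  by rewrite normr_ge0 andbT -fpos dual_evalB subr_le0 fxy.
by rewrite normr_eq0 => /eqP p0; rewrite -[y]add0r -p0 -levBlDr le_posv.
Qed.

Definition up_directed D :=
  forall x y, D x -> D y -> exists z, [/\ D z, x <= z & y <= z].

(** Some tail of D oscillates by less than e, for otherwise an increasing sequence in D with all
    gaps at least e could be built, against [increasing_gap_lt]. Points chosen from such tails form
    a Cauchy sequence, whose limit is b. *)
Lemma directed_sup D M : D !=set0 -> up_directed D ->
  (forall x, D x -> `|x| <= M) ->
  exists b, (forall x, D x -> x <= b) /\
    (forall e, 0 < e -> exists2 x, D x & `|x - b| < e).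
Proof.
move=> [x0 Dx0] Ddir DM.
have tail e : 0 < e ->
    exists x, D x /\ forall y, D y -> x <= y -> `|y - x| < e.
  move=> e0; apply: contrapT => ntail.
  pose ok x := [set y | [/\ D y, x <= y & e <= `|y - x|]].
  pose g x := xget x (ok x).
  have gP x : D x -> ok x (g x).
    move=> Dx; apply: xgetPex; apply: contrapT => nok; apply: ntail; exists x.
    split=> // y Dy xy; rewrite ltNge; apply/negP => exy; apply: nok.
    by exists y.
  have Dg n : D (iter n g x0) by elim: n => //= n /gP[].
  have [||n] := @increasing_gap_lt _ _ (fun n => iter n g x0) M e nc0 _ _ e0.
  - by move=> n /=; have [] := gP _ (Dg n).
  - by move=> n; exact: DM.
  - by have [_ _] := gP _ (Dg n); rewrite /= leNgt => /negP.
have /choice[c cP] (n : nat) : exists x,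
    D x /\ forall y, D y -> x <= y -> `|y - x| < n.+1%:R^-1.
  by apply: tail; rewrite invr_gt0.
have [|b cb] := cauchy_norm_limit (x := c).
  move=> e e0; have e2 : 0 < e / 2 by rewrite divr_gt0.
  have [N NP] := eventually_inv_lt e2; exists N => m n /NP mN /NP nN.
  have [Dm mP] := cP m; have [Dn nP] := cP n.
  have [z [Dz mz nz]] := Ddir _ _ Dm Dn.
  have := mP z Dz mz; have := nP z Dz nz.
  have := ler_distD z (c m) (c n); rewrite (distrC (c m) z).
  move: m.+1%:R^-1 n.+1%:R^-1 mN nN => p q; lra.
exists b; split=> [x Dx|e e0]; last first.
  by have [N /(_ N (leqnn N))] := cb e e0; exists (c N) => //; have [] := cP N.
(* A member of D above both x and a late c n is close to b, so x lies below points arbitrarily near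
   b. *)
apply: le_approx => e e0; have e2 : 0 < e / 2 by rewrite divr_gt0.
have [N NP] := eventually_inv_lt e2; have [K KP] := cb _ e2.
have := NP _ (leq_maxl N K); have := KP _ (leq_maxr N K).
move: (maxn N K) => n cn nn; have [Dn nP] := cP n.
have [z [Dz xz nz]] := Ddir _ _ Dx Dn; exists z => //.
have := nP z Dz nz; have := ler_distD (c n) z b.
by move: n.+1%:R^-1 nn => q; lra.
Qed.

Definition down_directed D :=
  forall x y, D x -> D y -> exists z, [/\ D z, z <= x & z <= y].

Lemma directed_inf D M : D !=set0 -> down_directed D ->
  (forall x, D x -> `|x| <= M) ->
  exists b, (forall x, D x -> b <= x) /\
    (forall e, 0 < e -> exists2 x, D x & `|x - b| < e).
Proof.
move=> [x0 Dx0] Ddir DM.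
have [|||b [bub bapp]] := @directed_sup [set - x | x in D] M.
- by exists (- x0), x0.
- move=> _ _ [x Dx <-] [y Dy <-]; have [z [Dz zx zy]] := Ddir x y Dx Dy.
  by exists (- z); rewrite !levN2; split=> //; exists z.
- by move=> _ [x Dx <-]; rewrite normrN DM.
exists (- b); split=> [x Dx|e /bapp[_ [x Dx <-] xb]].
  by rewrite levNl bub//; exists x.
by exists x => //; rewrite opprK -normrN opprD.
Qed.

(** The zeros of f in [0, s] are closed under joins, because a join of positive vectors is below
    their sum. They are therefore directed, and their supremum is a norm limit of zeros, hence a
    zero. *)
Lemma null_sup s (f : dual V) : 0 <= s -> pos_dual f ->
  (forall x, `|f x : R| <= `|x|) ->
  exists n, [/\ 0 <= n <= s, f n = 0
    & forall x, 0 <= x <= s -> f x = 0 -> x <= n].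
Proof.
move=> s0 f0 f1.
have [|||n [nub napp]] := @directed_sup [set x | 0 <= x <= s /\ f x = 0] `|s|.
- by exists 0 => /=; rewrite lexx s0 dual_eval0.
- move=> x y /= [/andP[x0 xs] fx] [/andP[y0 ys] fy].
  exists (Order.join x y); split; rewrite ?leUl ?leUr//; split.
    by rewrite leUx xs ys (le_trans x0) ?leUl.
  apply/le_anti; rewrite f0 ?andbT ?(le_trans x0) ?leUl//.
  have <- : f (x + y) = 0 by rewrite dual_evalD fx fy addr0.
  by rewrite pos_dual_le// leUx levDr// levDl.
- by move=> x /= [/andP[x0 xs] _]; exact: norm_ge0_le.
exists n; split; last by move=> x xs fx; apply: nub.
  rewrite nub/=; last by rewrite lexx s0 dual_eval0.
  by apply: ge_approx => e /napp[x /= [/andP[_ xs] _] xn]; exists x.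
apply/eqP; rewrite -normr_le0; apply/ler_addgt0Pr => e /napp[x /= [_ fx] xn].
have := f1 (x - n); rewrite dual_evalB fx sub0r normrN add0r => /le_trans; apply.
exact: ltW.
Qed.

(* w is the limsup of witnesses x_k chosen with f x_k < 2^-(k+1). *)
Lemma null_limsup s (f : dual V) e : 0 <= s -> pos_dual f ->
  (forall x, `|f x : R| <= `|x|) ->
  (forall d : R, 0 < d -> exists x, [/\ 0 <= x <= s, (f x : R) < d & e <= `|x|]) ->
  exists w, [/\ 0 <= w <= s, f w = 0 & e <= `|w|].
Proof.
move=> s0 f0 f1 fsmall.
have /choice[x xP] (k : nat) : exists x,
    [/\ 0 <= x <= s, (f x : R) < 2^-1 ^+ k.+1 & e <= `|x|].
  by apply: fsmall; rewrite exprn_gt0.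
have x0 k : 0 <= x k by have [/andP[]] := xP k.
have xs k : x k <= s by have [/andP[]] := xP k.
(* Truncated sums stand in for finite joins: [y m n] stays in [0, s], dominates x i for m <= i < n,
   and f is at most 2^-m on it. Then u m is its supremum over n, and w the infimum of the u m. *)
pose y m n := Order.meet s (\sum_(m <= i < n) x i).
have sum0 m n : 0 <= \sum_(m <= i < n) x i by exact: bl_sum_ge0.
have y0 m n : 0 <= y m n by rewrite lexI s0/=.
have ymono m n p : (n <= p)%N -> y m n <= y m p.
  move=> np; rewrite lexI leIl/=; apply: le_trans (leIr _ _) _.
  have [mn|/ltnW nm] := leqP m n; last by rewrite (big_geq nm); exact: sum0.
  by rewrite (big_cat_nat mn np) /= levDr//; exact: sum0.
have /choice[u uP] m : exists u, (forall z, range (y m) z -> z <= u) /\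
    (forall d, 0 < d -> exists2 z, range (y m) z & `|z - u| < d).
  apply: (@directed_sup _ `|s|); first by exists (y m 0%N), 0%N.
    move=> _ _ [n _ <-] [p _ <-]; exists (y m (maxn n p)).
    by split; [exists (maxn n p)|exact: ymono (leq_maxl _ _)|exact: ymono (leq_maxr _ _)].
  by move=> _ [n _ <-]; apply: norm_ge0_le => //; exact: leIl.
have xu k : x k <= u k.
  have [ub _] := uP k; apply: le_trans (ub (y k k.+1) _); last by exists k.+1.
  by rewrite /y big_nat1 lexI xs lexx.
have u0 k : 0 <= u k by exact: le_trans (x0 k) (xu k).
have us k : u k <= s.
  apply: ge_approx => d d0; have [_ /(_ d d0)[_ [n _ <-] yu]] := uP k.
  by exists (y k n) => //; exact: leIl.
have umono m p : (m <= p)%N -> u p <= u m.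
  move=> mp; apply: ge_approx => d d0; have [_ /(_ d d0)[_ [n _ <-] yu]] := uP p.
  exists (y p n) => //; have [ub _] := uP m; apply: le_trans (ub (y m n) _); last by exists n.
  rewrite lexI leIl/=; apply: le_trans (leIr _ _) _.
  have [pn|/ltnW np] := leqP p n; last by rewrite (big_geq np); exact: sum0.
  by rewrite (big_cat_nat mp pn) /= levDl//; exact: sum0.
have fu m : (f (u m) : R) <= 2^-1 ^+ m.
  apply/ler_addgt0Pr => d d0; have [_ /(_ d d0)[_ [n _ <-] yu]] := uP m.
  have fy : (f (y m n) : R) <= 2^-1 ^+ m.
    apply: le_trans (pos_dual_le f0 (leIr _ _)) _; rewrite raddf_sum /=.
    apply: le_trans (sum_half_powers m n); apply: ler_sum => i _.
    by have [_ /ltW] := xP i.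
  have := f1 (y m n - u m); rewrite dual_evalB ler_norml => /andP[].
  by lra.
have [|||w [wlb wapp]] := @directed_inf (range u) `|s|.
- by exists (u 0%N), 0%N.
- move=> _ _ [m _ <-] [p _ <-]; exists (u (maxn m p)).
  by split; [exists (maxn m p)|exact: umono (leq_maxl _ _)|exact: umono (leq_maxr _ _)].
- by move=> _ [n _ <-]; exact: norm_ge0_le.
have w0 : 0 <= w.
  by apply: le_approx => d /wapp[_ [m _ <-] uw]; exists (u m).
exists w; split.
- by rewrite w0 (le_trans (wlb (u 0%N) _))//; exists 0%N.
- apply/le_anti; rewrite f0// andbT; apply/ler_addgt0Pr => d d0; rewrite add0r.
  have [N /(_ N (leqnn N))] := half_powers_lt d0.
  move=> /ltW; apply: le_trans; apply: le_trans (fu N).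
  by apply: pos_dual_le => //; apply: wlb; exists N.
- apply/ler_addgt0Pr => d /wapp[_ [m _ <-] uw].
  have [_ _ em] := xP m; have := norm_ge0_le (x0 m) (xu m).
  by have := ler_normD (u m - w) w; rewrite subrK; lra.
Qed.

(* Otherwise the limsups w_f above are nonzero, and so is the infimum n of the
   directed family of the [null_sup] elements; but n is null for a functional
   norming it. *)
Lemma exists_controlling_pos_dual s e : 0 <= s -> 0 < e ->
  exists f : dual V, pos_dual f /\ exists2 d : R, 0 < d &
    forall x, 0 <= x <= s -> (f x : R) < d -> `|x| < e.
Proof.
move=> s0 e0; apply: contrapT => nctrl.
pose contr (f : dual V) := pos_dual f /\ forall x, `|f x : R| <= `|x|.
pose null_top (f : dual V) n := [/\ 0 <= n <= s, f n = 0
    & forall x, 0 <= x <= s -> f x = 0 -> x <= n].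
pose N := [set n | exists f, contr f /\ null_top f n].
have top f : contr f -> exists n, null_top f n by move=> [f0 f1]; exact: null_sup.
have Ns n : N n -> 0 <= n <= s by move=> [f [_ []]].
have Ne n : N n -> e <= `|n|.
  move=> [f [[f0 f1] [ns fn nmax]]].
  have [|w [/andP[w0 ws] fw ew]] := @null_limsup s f e s0 f0 f1.
    move=> d d0; apply: contrapT => nx; apply: nctrl; exists f; split=> //.
    exists d => // x xs fx; rewrite ltNge; apply/negP => ex; apply: nx.
    by exists x.
  by apply: le_trans ew _; apply: norm_ge0_le => //; apply: nmax => //; rewrite w0.
have [|||n [nlb napp]] := @directed_inf N `|s|.
- have [f [f0 f1 _]] := exists_norming_pos_dual (0 : V).
  by have [n fn] := top f (conj f0 f1); exists n, f.
- move=> n p [f [[f0 f1] [ns fn nmax]]] [g [[g0 g1] [ps gp pmax]]].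
  (* A positive zero of the mean is a common zero of f and g, so its largest zero lies below both n
     and p. *)
  pose h : dual V := 2^-1 *: (f + g).
  have hE x : h x = 2^-1 * (f x + g x) :> R by rewrite dualZE dualDE.
  have hc : contr h.
    split=> [x x0|x]; rewrite hE; first by rewrite mulr_ge0 ?invr_ge0// addr_ge0 ?f0 ?g0.
    by have := f1 x; have := g1 x; rewrite !ler_norml; lra.
  have [q [qs hq qmax]] := top h hc; exists q.
  have q0 : 0 <= q by case/andP: qs.
  have := f0 q q0; have := g0 q q0; have := hE q; rewrite hq => hq0 gq fq.
  split; [by exists h| |].
    by apply: nmax => //; apply/le_anti; rewrite fq andbT; move: hq0 gq; lra.
  by apply: pmax => //; apply/le_anti; rewrite gq andbT; move: hq0 fq; lra.
- by move=> n /Ns/andP[n0 ns]; exact: norm_ge0_le.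
have n0 : 0 <= n.
  by apply: le_approx => d /napp[x /Ns/andP[x0 _] xn]; exists x.
have en : e <= `|n|.
  apply/ler_addgt0Pr => d /napp[x /Ne ex xn].
  by have := ler_normD (x - n) n; rewrite subrK; lra.
have [f [f0 f1 fn]] := exists_norming_pos_dual n.
have [p fp] := top f (conj f0 f1); have [ps fp0 _] := fp.
have := pos_dual_le f0 (nlb p _); rewrite fp0 fn posv_id// => /(_ _).
by move=> /(_ (ex_intro _ f (conj (conj f0 f1) fp))); lra.
Qed.

End DirectedSets.

(** * Weak compactness of order intervals *)

Section LatticeSquare.
Context {R : realType} {V : banachLatticeType R}.
Implicit Types (s x y : V) (a b : R).

Lemma absvZ_half s x y : bl_abs x <= s -> bl_abs y <= s ->
  bl_abs (2^-1 *: (x + y)) <= s.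
Proof.
move=> xs ys; have half0 : 0 <= 2^-1 :> R by rewrite invr_ge0.
have -> : s = 2^-1 *: (s + s).
  by rewrite scalerDr -scalerDl -[LHS]scale1r; congr (_ *: _); lra.
move: xs ys; rewrite !absv_le => /andP[xs nxs] /andP[ys nys].
by rewrite -scalerN opprD !levZ// levD.
Qed.

(** Under a positive functional, with u and v the values at x and s, |u| <= v reduces the claim to
    (|t| - 1)^2 v >= 0. *)
Lemma tangent_le s x (t : R) : 0 <= s -> bl_abs x <= s ->
  (2 * t) *: x - t ^+ 2 *: s <= s.
Proof.
move=> s0; rewrite absv_le => /andP[xs nxs].
apply: pos_dual_levP => f f0.
have := pos_dual_le f0 xs; have := pos_dual_le f0 nxs.
have -> : f (- x) = - f x by rewrite -scaleN1r dual_evalZ mulN1r.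
have := f0 s s0; rewrite dual_evalB !dual_evalZ.
move: (f x : R) (f s : R) => u v v0 uv uv'.
have [t0|t0] := leP 0 t.
  have : t * u <= t * v by rewrite ler_wpM2l.
  have : 0 <= (t - 1) ^+ 2 * v by rewrite mulr_ge0// sqr_ge0.
  nra.
have : (- t) * - u <= (- t) * v by rewrite ler_wpM2l// oppr_ge0 ltW.
have : 0 <= (t + 1) ^+ 2 * v by rewrite mulr_ge0// sqr_ge0.
nra.
Qed.

(* Q x plays the role of x^2 / s, the supremum of its tangents. *)
Lemma exists_lattice_square s : dedekind_complete V -> 0 <= s ->
  exists Q : V -> V, forall x, bl_abs x <= s ->
    (forall t : R, (2 * t) *: x - t ^+ 2 *: s <= Q x) /\
    (forall y, (forall t : R, (2 * t) *: x - t ^+ 2 *: s <= y) -> Q x <= y).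
Proof.
move=> Vded s0.
have /choice[Q QP] x : exists q : V, bl_abs x <= s ->
    (forall t : R, (2 * t) *: x - t ^+ 2 *: s <= q) /\
    (forall y, (forall t : R, (2 * t) *: x - t ^+ 2 *: s <= y) -> q <= y).
  have [xs|nxs] := pselect (bl_abs x <= s); last by exists 0.
  have [|q [qub qlub]] := Vded (range (fun t : R => (2 * t) *: x - t ^+ 2 *: s)).
    split; first by eexists; exists 0.
    by exists s => _ [t _ <-]; exact: tangent_le.
  exists q => _; split=> [t|y yub]; first by apply: qub; exists t.
  by apply: qlub => _ [t _ <-].
by exists Q.
Qed.

Variables (s : V) (Q : V -> V).
Hypothesis s0 : 0 <= s.
Hypothesis QP : forall x, bl_abs x <= s ->
    (forall t : R, (2 * t) *: x - t ^+ 2 *: s <= Q x) /\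
    (forall y, (forall t : R, (2 * t) *: x - t ^+ 2 *: s <= y) -> Q x <= y).

Lemma lattice_square_ge0 x : bl_abs x <= s -> 0 <= Q x.
Proof.
move=> /QP[/(_ 0)]; by rewrite mulr0 expr0n/= !scale0r subr0.
Qed.

(** Twice the tangent terms of (x + y) / 2 at t and of (x - y) / 2 at r add up to the tangent terms
    of x at t + r and of y at t - r. Each Q on the left is then removed by its least upper bound
    property. *)
Lemma lattice_square_parallelogram x y : bl_abs x <= s -> bl_abs y <= s ->
  (2 : R) *: Q (2^-1 *: (x + y)) + (2 : R) *: Q (2^-1 *: (x - y)) <= Q x + Q y.
Proof.
move=> xs ys; have zs := absvZ_half xs ys.
have ds : bl_abs (2^-1 *: (x - y)) <= s by apply: absvZ_half; rewrite ?absvN.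
set z := 2^-1 *: (x + y) in zs *; set d := 2^-1 *: (x - y) in ds *.
have two_cancel (u v : V) : u <= (2^-1 : R) *: v -> (2 : R) *: u <= v.
  move=> /(levZ (ler0n R 2)); rewrite scalerA mulfV ?pnatr_eq0// scale1r.
  exact.
rewrite -levBrDr; apply: two_cancel; apply: (QP zs).2 => t.
have two_cancel' (u v w : V) : u <= (2^-1 : R) *: (w - (2 : R) *: v) ->
    v <= (2^-1 : R) *: (w - (2 : R) *: u).
  move=> uvw; apply: pos_dual_levP => f f0; have := pos_dual_le f0 uvw.
  by rewrite !(dual_evalZ, dual_evalB); lra.
apply: two_cancel'; apply: (QP ds).2 => r.
apply: pos_dual_levP => f f0.
have := pos_dual_le f0 ((QP xs).1 (t + r)).
have := pos_dual_le f0 ((QP ys).1 (t - r)).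
rewrite /z /d !(dual_evalZ, dual_evalB, dual_evalD).
move: (f x : R) (f y : R) (f s : R) (f (Q x) : R) (f (Q y) : R) => fx fy fs fqx fqy.
rewrite !sqrrD !sqrrN; move=> h1 h2.
nra.
Qed.

(** The tangents at r and - r together give 2 r |x| <= Q x + r^2 s. *)
Lemma absv_le_lattice_square x (r : R) (f : dual V) : pos_dual f ->
  bl_abs x <= s -> 0 < r ->
  (f (bl_abs x) : R) <= (f (Q x) + r ^+ 2 * f s) / (2 * r).
Proof.
move=> f0 xs r0.
suff : bl_abs x <= (2 * r)^-1 *: (Q x + r ^+ 2 *: s).
  by move=> /(pos_dual_le f0); rewrite dual_evalZ dual_evalD dual_evalZ mulrC.
have r2 : 0 < 2 * r by rewrite mulr_gt0.
have scale u : (2 * r) *: u - r ^+ 2 *: s <= Q x ->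
    u <= (2 * r)^-1 *: (Q x + r ^+ 2 *: s).
  rewrite levBlDr => /(levZ (ltW (etrans (invr_gt0 _) r2))).
  by rewrite scalerA mulVf ?scale1r// gt_eqF.
rewrite absv_le !scale//; first exact: (QP xs).1.
by have := (QP xs).1 (- r); rewrite sqrrN mulrN scaleNr scalerN.
Qed.

End LatticeSquare.

Section ConvexIntersections.
Context {R : realType} {V : banachLatticeType R}.
Hypothesis nc0 : ~ c0_embeds V.
Hypothesis Vded : dedekind_complete V.
Implicit Types (s x y : V) (C K : set V) (F : set (set V)).

(** The parallelogram inequality involves only midpoints, so closure under them takes the place of
    convexity. *)
Definition midconvex C := forall x y, C x -> C y -> C ((2^-1 : R) *: (x + y)).

Lemma midconvexI C K : midconvex C -> midconvex K -> midconvex (C `&` K).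
Proof. by move=> Cm Km x y [Cx Kx] [Cy Ky]; split; [exact: Cm|exact: Km]. Qed.

(* K collects the near-minimizers of the uniformly convex functional f \o Q,
   where f controls the norm on [0, s]. *)
Lemma small_midconvex_meeting F s (C0 : set V) (e : R) :
  (forall C, F C -> midconvex C) ->
  (forall C C', F C -> F C' -> F (C `&` C')) ->
  (forall C, F C -> C !=set0) ->
  F C0 -> (forall x, C0 x -> bl_abs x <= s) -> 0 < e ->
  exists K, [/\ midconvex K, forall x y, K x -> K y -> `|x - y| < e
    & forall C, F C -> C `&` K !=set0].
Proof.
move=> Fm FI Fn FC0 C0s e0.
have s0 : 0 <= s by have [x /C0s] := Fn _ FC0; apply: le_trans; exact: absv_ge0.
have e2 : 0 < e / 2 by rewrite divr_gt0.
have [f [f0 [d d0 fd]]] := exists_controlling_pos_dual nc0 s0 e2.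
have [Q QP] := exists_lattice_square Vded s0.
have fs0 := f0 s s0.
pose Phi x : R := f (Q x).
have Phi_ge0 x : bl_abs x <= s -> 0 <= Phi x.
  by move=> xs; apply: f0; exact: (lattice_square_ge0 QP).
have Phi_le x : bl_abs x <= s -> Phi x <= f s.
  move=> xs; apply: pos_dual_le => //; apply: (QP x xs).2 => t. exact: tangent_le.
have Phi_par x y : bl_abs x <= s -> bl_abs y <= s ->
    2 * Phi (2^-1 *: (x + y)) + 2 * Phi (2^-1 *: (x - y)) <= Phi x + Phi y.
  move=> xs ys; have := pos_dual_le f0 (lattice_square_parallelogram QP xs ys).
  by rewrite !(dual_evalD, dual_evalZ).
(* The constants make f |h| < d for half-differences h of near-minimizers: r f s < d, and Phi h < 2
   eta = r d by the parallelogram inequality, so (Phi h + r^2 f s) / (2 r) < d. *)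
pose r := d / (f s + 1); have r0 : 0 < r by rewrite divr_gt0// ltr_wpDl.
have r2 : 0 < 2 * r by rewrite pmulr_rgt0.
have rfs : r * f s < d.
  by rewrite /r mulrAC ltr_pdivrMr ?ltr_wpDl// ltr_pM2l// ltrDl.
pose eta := r * d / 2; have eta0 : 0 < eta by rewrite /eta divr_gt0// mulr_gt0.
(* Its supremum m is the supremum, over C in F, of the infimum of Phi on the intersection of C and
   C0; C1 attains it up to eta. *)
pose L := [set c | exists2 C, F C & forall x, C x -> C0 x -> c <= Phi x].
have supL : has_sup L.
  split; first by exists 0, C0 => // x _ /C0s; exact: Phi_ge0.
  exists (f s) => c [C FC cC]; have [x [Cx C0x]] := Fn _ (FI _ _ FC FC0).
  by apply: le_trans (cC x Cx C0x) _; apply: Phi_le; exact: C0s.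
have [c [C1 FC1 cC1] mc] := sup_adherent eta0 supL; set m := sup L in mc.
have near_min C : F C -> exists x, [/\ C x, C0 x & Phi x < m + eta].
  move=> FC; apply: contrapT => nx.
  have : L (m + eta).
    exists C => // x Cx C0x; rewrite leNgt; apply/negP => xm; apply: nx.
    by exists x.
  by move=> /(sup_upper_bound supL); rewrite gerDl leNgt eta0.
have C10_lb x : C1 x -> C0 x -> m - eta < Phi x.
  by move=> C1x C0x; apply: lt_le_trans mc _; exact: cC1.
exists [set x | [/\ C1 x, C0 x & Phi x < m + eta]]; split.
- move=> x y [C1x C0x xm] [C1y C0y ym].
  have xs := C0s _ C0x; have ys := C0s _ C0y.
  split; [exact: Fm|exact: Fm|].
  have := Phi_par _ _ xs ys.
  have : 0 <= Phi (2^-1 *: (x - y)).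
    by apply/Phi_ge0/absvZ_half => //; rewrite absvN.
  lra.
- move=> x y [C1x C0x xm] [C1y C0y ym].
  have xs := C0s _ C0x; have ys := C0s _ C0y.
  have := Phi_par _ _ xs ys.
  have := C10_lb _ (Fm _ FC1 _ _ C1x C1y) (Fm _ FC0 _ _ C0x C0y).
  have ds : bl_abs (2^-1 *: (x - y)) <= s by apply: absvZ_half; rewrite ?absvN.
  have := absv_le_lattice_square QP f0 ds r0; rewrite -/(Phi _).
  set h := 2^-1 *: (x - y) in ds *.
  move=> fh zm par.
  have Phih : Phi h < r * d by move: par zm; rewrite /eta in xm ym *; lra.
  have fhd : (f (bl_abs h) : R) < d.
    apply: le_lt_trans fh _; rewrite (ltr_pdivrMr _ _ r2).
    have : r * (r * f s) < r * d by rewrite ltr_pM2l.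
    by rewrite expr2 -mulrA; lra.
  have : `|bl_abs h| < e / 2 by apply: fd => //; rewrite absv_ge0.
  by rewrite norm_absv normrZ ger0_norm//; move: (`|x - y|) => q; lra.
- move=> C FC; have [x [[Cx C1x] C0x xm]] := near_min _ (FI _ _ FC FC1).
  by exists x.
Qed.

(** Iterating [small_midconvex_meeting] gives decreasing sets with diameters tending to 0, each
    meeting every member of F. Points picked from them are Cauchy, and their limit is within every
    distance of each member of F. *)
Lemma midconvex_family_limit F s (C0 : set V) :
  (forall C, F C -> midconvex C) ->
  (forall C C', F C -> F C' -> F (C `&` C')) ->
  (forall C, F C -> C !=set0) ->
  F C0 -> (forall x, C0 x -> bl_abs x <= s) ->
  exists y, forall C, F C -> forall e : R, 0 < e -> exists2 x, C x & `|x - y| < e.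
Proof.
move=> Fm FI Fn FC0 C0s.
pose good K := midconvex K /\ forall C, F C -> C `&` K !=set0.
have /choice[g gP] (Kn : set V * nat) : exists K', good Kn.1 ->
    [/\ good K', K' `<=` Kn.1
      & forall x y, K' x -> K' y -> `|x - y| < Kn.2.+1%:R^-1].
  case: Kn => K n /=; have [[Km KF]|] := pselect (good K); last by exists set0.
  (* Working with the traces of F on K ensures that the part of K' inside K still meets every member
     of F. *)
  have [||||||K' [K'm K'd K'F]] :=
    @small_midconvex_meeting [set C `&` K | C in F] s (C0 `&` K) n.+1%:R^-1.
  - by move=> _ [C FC <-]; apply: midconvexI => //; exact: Fm.
  - move=> _ _ [C FC <-] [C' FC' <-]; exists (C `&` C'); first exact: FI.
    by rewrite setIACA setIid.
  - by move=> _ [C FC <-]; exact: KF.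
  - by exists C0.
  - by move=> x [/C0s].
  - by rewrite invr_gt0.
  exists (K `&` K') => _; split.
  - split; first exact: midconvexI.
    by move=> C FC; rewrite setIA; apply: K'F; exists C.
  - by move=> x [].
  - by move=> x y [_ K'x] [_ K'y]; exact: K'd.
(* [Ks 0] is the whole space, so diameters are controlled only from [Ks n.+1] on. *)
pose Ks := fix Ks n := if n is n'.+1 then g (Ks n', n') else setT.
have Kgood n : good (Ks n).
  elim: n => [|n /(gP (_, n))[]//]; split=> // C FC; rewrite setIT; exact: Fn.
have Kdiam n x y : Ks n.+1 x -> Ks n.+1 y -> `|x - y| < n.+1%:R^-1.
  by have [_ _] := gP (_, n) (Kgood n); apply.
have Ksub m n : (m <= n)%N -> Ks n `<=` Ks m.
  elim: n => [|n IHn]; rewrite leq_eqVlt => /orP[/eqP->//|//] /IHn mn.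
  by apply: subset_trans mn; have [] := gP (_, n) (Kgood n).
have /choice[x xK] n : exists x, Ks n.+1 x.
  by have [_ /(_ _ FC0)[x [_ Kx]]] := Kgood n.+1; exists x.
have xdist n m : (n <= m)%N -> forall z, Ks n.+1 z -> `|x m - z| < n.+1%:R^-1.
  by move=> nm z Kz; apply: Kdiam => //; apply: Ksub (xK m).
have [|y xy] := cauchy_norm_limit (x := x).
  move=> e e0; have e2 : 0 < e / 2 by rewrite divr_gt0.
  have [N /(_ N (leqnn N))] := eventually_inv_lt e2; move=> NP.
  exists N => m n Nm Nn.
  have mN := lt_trans (xdist N m Nm _ (xK N)) NP.
  have nN := lt_trans (xdist N n Nn _ (xK N)) NP.
  apply: le_lt_trans (ler_distD (x N) _ _) _.
  by rewrite (distrC (x N)) [e]splitr ltrD.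
exists y => C FC e e0; have e2 : 0 < e / 2 by rewrite divr_gt0.
have [N NP] := eventually_inv_lt e2; have [M MP] := xy _ e2.
have := NP _ (leq_maxl N M); have := MP _ (leq_maxr N M).
move: (maxn N M) => n xny nN.
have [_ /(_ _ FC)[z [Cz Kz]]] := Kgood n.+1; exists z => //.
have xz := lt_trans (xdist n n (leqnn n) z Kz) nN.
by rewrite (le_lt_trans (ler_distD (x n) _ _))// [e]splitr ltrD// distrC.
Qed.

End ConvexIntersections.

(** * Convergence in the weak topology *)

Lemma cvg_initial_topology (S : choiceType) (T : topologicalType) (f : S -> T)
    (F : set_system S) (s : S) : Filter F ->
  f @ F --> f s -> F --> (s : initial_topology f).
Proof.
move=> FF fF A /= [_ [[B Bop <-] Bfs sBfA]].
rewrite nbhs_filterE; apply: filterS sBfA _.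
by have /fF : nbhs (f s) B by rewrite nbhsE; exists B.
Qed.

Section WeakTopology.
Context {R : realType} {X : normedModType R}.

Lemma weak_eval_continuous (f : dual X) :
  continuous ((fun x => f x) : weak X -> R^o).
Proof.
move=> x; apply: (@continuous_comp (weak X) {ptws dual X -> R^o} R^o
  (fun x : X => (fun g : dual X => g x) : {ptws dual X -> R^o}) (proj f)).
  exact: initial_continuous.
exact: proj_continuous.
Qed.

Lemma weak_cvg (U : set_system (weak X)) (y : X) : Filter U ->
  (forall f : dual X, (fun x : weak X => f x : R^o) @ U --> (f y : R^o)) ->
  U --> (y : weak X).
Proof.
move=> FU fU; apply: cvg_initial_topology; apply/cvg_sup => f.
by apply: cvg_initial_topology; exact: fU.
Qed.

End WeakTopology.

Section WeaklyCompactIntervals.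
Context {R : realType} {V : banachLatticeType R}.
Hypothesis nc0 : ~ c0_embeds V.
Hypothesis Vded : dedekind_complete V.
Variables a b : V.

Let I : set (weak V) := [set x : V | a <= x <= b].

(** By [pos_dual_levP] the interval is an intersection of half-spaces given by positive functionals,
    each weakly closed. *)
Lemma order_interval_weakly_closed : closed I.
Proof.
have halfspace (f : dual V) (C : set R) : closed (C : set R^o) ->
    (forall x, I x -> C (f x)) -> forall x, closure I x -> C (f x).
  move=> Ccl IC x Ix.
  pose P := (fun x : weak V => f x : R^o) @^-1` C.
  have Pcl : closed P by apply: closed_comp => // z _; exact: weak_eval_continuous.
  by have : closure P x; [exact: closure_subset IC _ Ix|rewrite -((closure_id P).1 Pcl)].
move=> x Ix; apply/andP; split; apply: pos_dual_levP => f f0.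
  apply: (halfspace f [set r | (f a : R) <= r]) Ix; first exact: closed_ge.
  by move=> z /andP[az _]; exact: pos_dual_le.
apply: (halfspace f [set r | r <= (f b : R)]) Ix; first exact: closed_le.
by move=> z /andP[_ zb]; exact: pos_dual_le.
Qed.

Lemma midconvex_halfspace (f : dual V) (c : R) :
  midconvex [set x : V | c <= (f x : R)] /\ midconvex [set x : V | (f x : R) <= c].
Proof.
by split=> x y /= xc yc; rewrite dual_evalZ dual_evalD; lra.
Qed.

Lemma midconvex_interval : midconvex (I : set V).
Proof.
move=> x y /andP[ax xb] /andP[ay yb]; apply/andP; split;
  apply: pos_dual_levP => f f0; rewrite dual_evalZ dual_evalD.
  by have := pos_dual_le f0 ax; have := pos_dual_le f0 ay; lra.
by have := pos_dual_le f0 xb; have := pos_dual_le f0 yb; lra.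
Qed.

Lemma order_interval_weakly_compact : compact I.
Proof.
rewrite compact_ultra => U UU UI.
have FU : Filter U by exact: filter_filter.
pose F := [set C : set V | midconvex C /\ U C].
have [|||||y yP] := @midconvex_family_limit _ _ nc0 Vded F (bl_abs a + bl_abs b) I.
- by move=> C [].
- move=> C C' [Cm UC] [C'm UC']; split; first exact: midconvexI.
  exact: (@filterI _ U FU).
- by move=> C [_ /filter_ex].
- by split=> //; exact: midconvex_interval.
- move=> x /andP[ax xb]; rewrite absv_le; apply/andP; split.
    by apply: le_trans xb (le_trans (le_absv b) _); rewrite levDl// absv_ge0.
  apply: (@le_trans _ _ (- a)); first by rewrite levN2.
  by apply: le_trans (leN_absv a) _; rewrite levDr// absv_ge0.
have Uy : U --> (y : weak V).
  apply: weak_cvg => f; apply/cvgrPdist_lt => e e0.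
  have e1 : 0 < e / (`|f| + 1) by rewrite divr_gt0// ltr_wpDl.
  have far C : midconvex C -> U C -> exists2 x, C x & `|(f x : R) - f y| < e.
    move=> Cm UC; have [x Cx xy] := yP C (conj Cm UC) _ e1; exists x => //.
    rewrite -dual_evalB; apply: le_lt_trans (dual_eval_le _ _) _.
    apply: (@le_lt_trans _ _ ((`|f| + 1) * `|x - y|)).
      by rewrite ler_wpM2r// lerDl.
    by rewrite mulrC -ltr_pdivlMr// ltr_wpDl.
  (* Half-spaces are midconvex, so one belonging to U would contain points norm close to y. Hence
     neither half-space where f differs from f y by at least e is in U. *)
  have [m1 _] := midconvex_halfspace f (f y + e).
  have [_ m2] := midconvex_halfspace f (f y - e).
  have [U1|U1] := in_ultra_setVsetC [set x : V | (f y : R) + e <= f x] UU.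
    have [x /= x1] := far _ m1 U1; rewrite ltr_norml; lra.
  have [U2|U2] := in_ultra_setVsetC [set x : V | (f x : R) <= f y - e] UU.
    have [x /= x2] := far _ m2 U2; rewrite ltr_norml; lra.
  apply: (@filterS _ U FU) (@filterI _ U FU _ _ U1 U2) => x /= [/negP + /negP].
  by rewrite -!ltNge ltr_norml; lra.
exists y; split=> //.
rewrite (closure_id I).1; last exact: order_interval_weakly_closed.
move=> B /Uy UB; have [z [Iz Bz]] := filter_ex (filterI UI UB).
by exists z.
Qed.

Lemma order_bounded_weakly_compact (A : set V) :
  A `<=` I -> relatively_weakly_compact A.
Proof.
move=> AI; apply: (subclosed_compact _ order_interval_weakly_compact).
  exact: closed_closure.
by rewrite (closure_id I).1; [exact: closure_subset|exact: order_interval_weakly_closed].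
Qed.

End WeaklyCompactIntervals.

(** * Positive operators and the modulus *)

Section PositiveOperators.
Context {R : realType} {E F : banachLatticeType R}.

Definition positive_operator (S : {linear E -> F}) := forall x : E, 0 <= x -> 0 <= S x.

Lemma positive_operator_le (S : {linear E -> F}) x y :
  positive_operator S -> x <= y -> S x <= S y.
Proof. by move=> S0 xy; rewrite -subv_ge0 -raddfB S0// subv_ge0. Qed.

(** If S were unbounded, there would be positive x n of norm at most 2^-(n+1) with S (x n) of norm
    at least n. The sum l of the series dominates every x n, so the norm of S l would be at least
    every n. *)
Lemma positive_operator_bounded (S : {linear E -> F}) : positive_operator S ->
  exists2 M : R, 0 <= M & forall x, `|S x| <= M * `|x|.
Proof.
move=> S0; apply: contrapT => nM.
have normS z : `|S z| <= `|S (bl_abs z)|.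
  apply: norm_le_of_absv; rewrite absv_le -raddfN.
  by rewrite !positive_operator_le ?le_absv ?leN_absv.
have /choice[x xP] (n : nat) : exists x : E,
    [/\ 0 <= x, `|x| <= 2^-1 ^+ n.+1 & n%:R <= `|S x|].
  pose c : R := 2^-1 ^+ n.+1; have c0 : 0 < c by rewrite exprn_gt0.
  have K0 : 0 <= n%:R / c by rewrite divr_ge0// ltW.
  have [z zP] : exists z, n%:R / c * `|z| < `|S z|.
    apply: contrapT => nz; apply: nM; exists (n%:R / c) => // z.
    by rewrite leNgt; apply/negP => zP; apply: nz; exists z.
  have z0 : 0 < `|z|.
    rewrite normr_gt0; apply/eqP => z0.
    by move: zP; rewrite z0 raddf0 !normr0 mulr0 ltxx.
  have cz0 : 0 <= c / `|z| by rewrite divr_ge0// ltW.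
  exists ((c / `|z|) *: bl_abs z); split.
  - by rewrite scalev_ge0// absv_ge0.
  - by rewrite normrZ ger0_norm// norm_absv divfK// gt_eqF.
  - rewrite linearZ normrZ ger0_norm//.
    apply: (@le_trans _ _ (c / `|z| * (n%:R / c * `|z|))); last first.
      by rewrite ler_wpM2l// (le_trans (ltW zP)).
    have -> : c / `|z| * (n%:R / c * `|z|) = n%:R; last by [].
    move: n%:R `|z| z0 c0 => N t t0 c0; field.
    by rewrite !gt_eqF.
have x0 n : 0 <= x n by have [] := xP n.
pose s n := \sum_(0 <= i < n) x i.
have sdist m n : (m <= n)%N -> `|s n - s m| <= 2^-1 ^+ m.
  move=> mn; rewrite /s (big_cat_nat (leq0n m) mn) /= addrAC subrr add0r.
  apply: le_trans (ler_norm_sum _ _ _) _; apply: le_trans (sum_half_powers m n).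
  by apply: ler_sum => i _; have [] := xP i.
have [|l sl] := cauchy_norm_limit (x := s).
  move=> e e0; have e2 : 0 < e / 2 by rewrite divr_gt0.
  have [N /(_ N (leqnn N)) Ne] := half_powers_lt e2; exists N => m n Nm Nn.
  apply: le_lt_trans (ler_distD (s N) _ _) _.
  by rewrite (distrC (s N)) [e]splitr ltrD// (le_lt_trans (sdist _ _ _)).
have xl n : x n <= l.
  apply: le_approx => e /sl[N NP].
  exists (s (maxn N n.+1)); last exact: NP (leq_maxl _ _).
  rewrite /s (big_cat_nat (leq0n n.+1) (leq_maxr _ _)) /= big_nat_recr//=.
  by rewrite -addrA addrC -addrA levDr// addv_ge0// bl_sum_ge0.
have := archi_boundP (normr_ge0 (S l)); set N := Num.bound _.
have [_ _ NS] := xP N.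
have : `|S (x N)| <= `|S l|.
  by apply: norm_ge0_le; [exact: S0|exact: positive_operator_le].
by move: NS; set t : R := N%:R; lra.
Qed.

Lemma pos_dual_contraction (f g : dual F) : (forall x, `|f x : R| <= `|x|) ->
  pos_dual g -> pos_dual (f - g) -> forall x, `|g x : R| <= `|x|.
Proof.
move=> f1 g0 fg0 x; have gf : (g (bl_abs x) : R) <= f (bl_abs x).
  by rewrite -subr_ge0 -dualBE fg0// absv_ge0.
have := f1 (bl_abs x); rewrite norm_absv; apply: le_trans.
apply: le_trans (ler_norm _); apply: le_trans gf.
have gN : g (- x) = - g x by rewrite -scaleN1r dual_evalZ mulN1r.
by rewrite ler_norml lerNl -gN !pos_dual_le ?le_absv ?leN_absv.
Qed.

(* The elements of F squeezed between S'' p and S'' q form a set directed in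
   both directions, whose supremum and infimum lie in F. *)
Lemma order_bounded_image (S : {linear E -> F}) (A : set E) :
  ~ c0_embeds F -> positive_operator S -> b_order_bounded A ->
  exists a b : F, forall x, A x -> a <= S x <= b.
Proof.
move=> nc0 S0 [p [q Apq]].
have [[x0 Ax0]|A0] := pselect (A !=set0); last first.
  by exists 0, 0 => x Ax; exfalso; apply: A0; exists x.
have [M M0 SM] := positive_operator_bounded S0.
(* This is the adjoint of S, so p (adj f) is the value of S'' p at f. *)
have /choice[adj adjP] (f : dual F) : exists h : dual E, forall x, h x = f (S x).
  pose h := HB.pack_for {linear E -> R^o} (fun x : E => f (S x) : R^o)
    (GRing.isLinear.Build R E R^o *:%R _ (fun a x y => 
       etrans (f_equal (dual_fun f) (linearP S a x y)) (linearP f a (S x) (S y)))).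
  have [|g gP] := @dual_of_linear _ _ h (`|f| * M); last by exists g.
  move=> x; apply: le_trans (dual_eval_le _ _) _.
  by rewrite -mulrA ler_wpM2l.
have adjB f g : adj f = adj g + adj (f - g).
  apply/val_inj/funext => x; rewrite -[LHS]/(adj f x).
  by rewrite -[RHS]/((adj g + adj (f - g)) x) dualDE !adjP dualBE addrC subrK.
have adj_pos f : pos_dual f -> dual_le 0 (adj f).
  by move=> f0; apply/pos_dualP => x /S0/f0; rewrite adjP.
pose D := [set y | forall f, pos_dual f -> (p (adj f) : R) <= f y <= q (adj f)].
(* Bounding g y and (f - g) z separately by q bounds f at the join by q (adj f), so D is closed
   under joins; meets follow from y + z. *)
have join_eval f y z : pos_dual f -> exists g : dual F,
    [/\ pos_dual g, pos_dual (f - g)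
      & f (Order.join y z) = g y + (f - g) z :> R].
  move=> f0; have [g [g0 fg0 gE]] := exists_pos_dual_split (y - z) f0.
  exists g; split=> //; rewrite joinvE dual_evalD -gE dual_evalB dualBE.
  by rewrite addrA addrAC -addrA.
have Djoin y z : D y -> D z -> D (Order.join y z).
  move=> Dy Dz f f0; have [g [g0 fg0 fE]] := join_eval f y z f0.
  have := Dy _ g0; have := Dz _ fg0; have := Dy _ f0.
  rewrite fE (adjB f g) !dual_evalD.
  have := pos_dual_le f0 (leUl y z : y <= Order.join y z); rewrite fE; lra.
have Dmeet y z : D y -> D z -> D (Order.meet y z).
  move=> Dy Dz f f0; have [g [g0 fg0 fE]] := join_eval f y z f0.
  have := Dy _ fg0; have := Dz _ g0; have := Dy _ f0.
  have := pos_dual_le f0 (leIl y z : Order.meet y z <= y).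
  have : f (Order.meet y z) = f y + f z - f (Order.join y z) :> R.
    by rewrite -dual_evalD -joinv_meetv dual_evalD addrAC subrr add0r.
  rewrite fE (adjB f g) !dual_evalD !dualBE; lra.
have Dnorm y : D y -> `|y| <= (`|q| + `|p|) * M.
  move=> Dy; have [f [f0 f1]] := exists_norming_pos_dual (bl_abs y).
  rewrite posv_id ?absv_ge0// norm_absv => <-.
  (* The norm of y is f |y| = g y - (f - g) y with both functionals positive contractions: q bounds
     the first term above and p bounds (f - g) y below. *)
  have [g [g0 fg0 gE]] := exists_pos_dual_split y f0.
  have adjM (h : dual F) : (forall x, `|h x : R| <= `|x|) -> `|adj h| <= M.
    by move=> h1; apply: dual_norm_le => // x; rewrite adjP (le_trans (h1 _)).
  have /adjM gM := pos_dual_contraction f1 g0 fg0.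
  have /adjM fgM : forall x, `|(f - g) x : R| <= `|x|.
    by apply: (pos_dual_contraction f1) => //; rewrite opprB addrC subrK.
  have fabs : f (bl_abs y) = g y - (f - g) y :> R.
    have -> : bl_abs y = bl_pos y + bl_pos y - y.
      by rewrite -posvD_absv -[in X in _ = _ - X](posvB y) opprB addrACA subrr addr0.
    by rewrite dual_evalB dual_evalD -gE dualBE; lra.
  have := Dy _ g0; have := Dy _ fg0.
  have := dual_eval_le q (adj g); have := dual_eval_le p (adj (f - g)).
  rewrite !ler_norml fabs.
  have : `|q| * `|adj g| <= `|q| * M by rewrite ler_wpM2l.
  have : `|p| * `|adj (f - g)| <= `|p| * M by rewrite ler_wpM2l.
  lra.
have AD x : A x -> D (S x).
  move=> Ax f /adj_pos f0; have [px qx] := Apq x Ax.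
  by rewrite -adjP; apply/andP; split; [exact: px|exact: qx].
have Dn0 : D !=set0 by exists (S x0); exact: AD.
have [|b [bub _]] := directed_sup nc0 Dn0 _ Dnorm.
  by move=> y z Dy Dz; exists (Order.join y z); rewrite leUl leUr; split=> //; exact: Djoin.
have [|a [alb _]] := directed_inf nc0 Dn0 _ Dnorm.
  by move=> y z Dy Dz; exists (Order.meet y z); rewrite leIl leIr; split=> //; exact: Dmeet.
by exists a, b => x /AD Dx; rewrite alb// bub.
Qed.

(** The Riesz-Kantorovich construction: on the positive cone the modulus at x is the supremum m x of
    T over [-x, x]. Riesz decomposition makes m additive, and it extends linearly by differences. *)
Lemma exists_modulus (T : {linear E -> F}) : dedekind_complete F ->
  order_bounded_operator T -> exists S : {linear E -> F}, is_modulus T S.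
Proof.
move=> Fded Tob.
have interval0 (x : E) : 0 <= x -> - x <= 0 <= x by move=> x0; rewrite oppv_le0 x0.
have /choice[m mP] (x : E) : exists b : F, 0 <= x ->
    (forall y, - x <= y <= x -> T y <= b) /\
    (forall z, (forall y, - x <= y <= x -> T y <= z) -> b <= z).
  have [x0|nx0] := pselect (0 <= x); last by exists 0.
  have [|c [d Tcd]] := Tob [set y | - x <= y <= x].
    by exists (- x), x.
  have [|b [bub blub]] := Fded (T @` [set y | - x <= y <= x]).
    split; first by exists (T 0), 0 => //; exact: interval0.
    by exists d => _ [y yx <-]; have /andP[] := Tcd (T y) (ex_intro2 _ _ y yx erefl).
  exists b => _; split=> [y yx|z zub]; first by apply: bub; exists y.
  by apply: blub => _ [y yx <-]; exact: zub.
have m_ub x y : 0 <= x -> - x <= y <= x -> T y <= m x by move=> /mP[+ _]; apply.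
have m_le x z : 0 <= x -> (forall y, - x <= y <= x -> T y <= z) -> m x <= z.
  by move=> /mP[_]; apply.
have mD (x z : E) : 0 <= x -> 0 <= z -> m (x + z) = m x + m z.
  move=> x0 z0; have xz0 := addv_ge0 x0 z0; apply/le_anti/andP; split.
    apply: (m_le) => // y /(riesz_decomposition x0 z0)[y1 [y2 [-> y1x y2z]]].
    by rewrite raddfD levD// m_ub.
  rewrite -levBrDr; apply: (m_le) => // y /andP[yl yu].
  rewrite levBrDr addrC -levBrDr; apply: (m_le) => // t /andP[tl tu].
  rewrite levBrDr -raddfD m_ub// opprD [t + y]addrC.
  by apply/andP; split; exact: levD.
have m0 : m 0 = 0.
  by have := mD 0 0 (lexx _) (lexx _); rewrite addr0 => /(f_equal (fun u => u - m 0)); rewrite addrK subrr.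
have mZ (a : R) (x : E) : 0 <= a -> 0 <= x -> m (a *: x) = a *: m x.
  have mZle (c : R) (z : E) : 0 < c -> 0 <= z -> m (c *: z) <= c *: m z.
    move=> c0 z0; have ci0 : 0 <= c^-1 by rewrite invr_ge0 ltW.
    apply: (m_le) => [|y /andP[yl yu]]; first by rewrite scalev_ge0// ltW.
    have -> : y = c *: (c^-1 *: y) by rewrite scalerA mulfV ?gt_eqF// scale1r.
    rewrite linearZ; apply: levZ; first exact: ltW.
    apply: m_ub => //; have := levZ ci0 yu; have := levZ ci0 yl.
    by rewrite scalerN !scalerA mulVf ?gt_eqF// scale1r => -> ->.
  rewrite le_eqVlt => /orP[/eqP<-|a0] x0; first by rewrite !scale0r.
  apply/le_anti; rewrite mZle//=.
  have ai0 : 0 < a^-1 by rewrite invr_gt0.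
  have := levZ (ltW a0) (mZle _ (a *: x) ai0 (scalev_ge0 (ltW a0) x0)).
  by rewrite !scalerA mulVf ?gt_eqF// mulfV ?gt_eqF// !scale1r.
pose S (x : E) := m (bl_pos x) - m (bl_pos (- x)).
(* Additivity of m makes S independent of how a vector is written as a difference of positive ones;
   linearity of S is read off from suitable such writings. *)
have SE (u v : E) : 0 <= u -> 0 <= v -> S (u - v) = m u - m v.
  move=> u0 v0; set x := u - v.
  have : u + bl_pos (- x) = bl_pos x + v.
    have := posvB x; move: (bl_pos x) (bl_pos (- x)) => s t.
    rewrite /x => /eqP; rewrite subr_eq => /eqP ->.
    by rewrite addrAC subrK.
  move=> /(f_equal m); rewrite !mD ?posv_ge0// /S => e.
  apply/eqP; rewrite subr_eq addrAC eq_sym subr_eq.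
  by rewrite e.
have S_lin : linear S.
  move=> a x y; rewrite [S x]/S [S y]/S -{1}(posvB x) -{1}(posvB y).
  have := posv_ge0 x; have := posv_ge0 (- x); have := posv_ge0 y.
  have := posv_ge0 (- y).
  move: (bl_pos x) (bl_pos (- x)) (bl_pos y) (bl_pos (- y)) => u v w z z0 w0 v0 u0.
  have [a0|/ltW a0] := leP 0 a.
    have -> : a *: (u - v) + (w - z) = (a *: u + w) - (a *: v + z).
      by rewrite scalerBr opprD addrACA.
    by rewrite SE ?addv_ge0 ?scalev_ge0// !mD ?scalev_ge0// !mZ// scalerBr opprD addrACA.
  have Na0 : 0 <= - a by rewrite oppr_ge0.
  have -> : a *: (u - v) + (w - z) = ((- a) *: v + w) - ((- a) *: u + z).
    by rewrite scalerBr !scaleNr opprD opprK [RHS]addrACA [X in _ = X + _]addrC.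
  rewrite SE ?addv_ge0 ?scalev_ge0// !mD ?scalev_ge0// !mZ//.
  by rewrite scalerBr !scaleNr opprD opprK [LHS]addrACA [X in X + _ = _]addrC.
pose S' := HB.pack_for {linear E -> F} S (GRing.isLinear.Build R E F *:%R _ S_lin).
have S'E (x : E) : 0 <= x -> S' x = m x.
  by move=> x0; rewrite -[LHS]/(S x) -[x in S x]subr0 SE// m0 subr0.
exists S'; split=> [x x0|x x0|U TU NTU x x0]; rewrite S'E//.
- by apply: m_ub => //; rewrite lexx andbT; case/andP: (interval0 x x0) => h; apply: le_trans.
- rewrite -[X in X <= _]/(- T x) -raddfN; apply: m_ub => //.
  by rewrite lexx; case/andP: (interval0 x x0) => h; apply: le_trans.
- have U0 z : 0 <= z -> 0 <= U z.
    by move=> z0; apply: double_ge0; rewrite -(subrr (T z)) levD ?TU ?NTU.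
  apply: (m_le) => // y /andP[yl yu].
  (* Dominating T on y^+ and - T on y^- by U gives T y <= U |y| <= U x. *)
  have -> : T y = T (bl_pos y) + - T (bl_pos (- y)) by rewrite -raddfB posvB.
  apply: (@le_trans _ _ (U (bl_pos y) + U (bl_pos (- y)))).
    by apply: levD; [apply: TU|apply: NTU]; exact: posv_ge0.
  rewrite -raddfD posvD_absv; apply: (@positive_operator_le U) => //.
  by rewrite absv_le yu levNl.
Qed.

End PositiveOperators.

Theorem theorem2p3 (R : realType) (E F : banachLatticeType R)
    (T : {linear E -> F})
    (F_dedekind : dedekind_complete F)
    (T_order_bounded : order_bounded_operator T)
    (F_no_c0 : ~ c0_embeds F) :
  b_weakly_compact T /\
  exists2 absT : {linear E -> F}, is_modulus T absT & b_weakly_compact absT.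
Proof.
have [S modS] := exists_modulus F_dedekind T_order_bounded.
have [TS NTS _] := modS.
have S0 : positive_operator S.
  by move=> x x0; apply: double_ge0; rewrite -(subrr (T x)) levD ?TS ?NTS.
(* T is the difference of the positive operators S and D, so order bounds for their images combine
   into bounds for the image under T. *)
pose D := HB.pack_for {linear E -> F} (S \- T : E -> F)
  (GRing.isLinear.Build R E F *:%R _ (linearP (S \- T))).
have D0 : positive_operator D by move=> x x0; rewrite /= subv_ge0 TS.
split; last exists S => //; move=> A bA.
  have [a [b Sab]] := order_bounded_image F_no_c0 S0 bA.
  have [c [d Dcd]] := order_bounded_image F_no_c0 D0 bA.
  apply: (order_bounded_weakly_compact F_no_c0 F_dedekind (a := a - d) (b := b - c)).
  move=> _ [x Ax <-] /=; have /andP[ax xb] := Sab x Ax; have /andP[cx xd] := Dcd x Ax.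
  have -> : T x = S x - D x by rewrite /= opprB addrC subrK.
  by apply/andP; split; apply: levD; rewrite // levN2.
have [a [b Sab]] := order_bounded_image F_no_c0 S0 bA.
apply: (order_bounded_weakly_compact F_no_c0 F_dedekind (a := a) (b := b)).
by move=> _ [x Ax <-]; exact: Sab.
Qed.
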